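(* The initial degenerations of $\mathrm{Fl}^\circ(4)$ are smooth and irreducible; that is, for every $\vec w\in\mathrm{TFl}^\circ(4)$ the scheme $\mathrm{in}_{\vec w}\,\mathrm{Fl}^\circ(4)$ is smooth and irreducible.
   Context: Everything is over $\mathbb C$. $\mathrm{Fl}(4)$ is the variety of complete flags $F_1\subset F_2\subset F_3\subset\mathbb C^4$, $\dim F_j=j$, embedded in $\mathbb P(\wedge^1\mathbb C^4)\times\mathbb P(\wedge^2\mathbb C^4)\times\mathbb P(\wedge^3\mathbb C^4)$ by the Plücker embeddings, and $\mathrm{Fl}^\circ(4)$ is the open locus where all Plücker coordinates are nonzero, a closed subvariety of the torus $T=\prod_{j=1}^3\mathbb G_m^{\binom{[4]}{j}}/\mathbb G_m$ with cocharacter lattice $\prod_{j=1}^3\mathbb Z^{\binom{[4]}{j}}/\mathbb Z\mathbf 1$, where $\mathbf 1$ is the all-ones vector. For a closed subscheme $X^\circ$ of a torus with ideal $I^\circ$ in the Laurent polynomial ring and a real cocharacter $w$, the initial form of $f=\sum c_ux^u$ is the sum of the terms $c_ux^u$ with $\langle u,w\rangle$ minimal, $\mathrm{in}_wI^\circ$ is the ideal generated by the initial forms of elements of $I^\circ$, $\mathrm{Trop}(X^\circ)=\{w:\mathrm{in}_wI^\circ\neq\langle1\rangle\}$, and for $w\in\mathrm{Trop}(X^\circ)$ the initial degeneration $\mathrm{in}_wX^\circ$ is the subscheme of the torus cut out by $\mathrm{in}_wI^\circ$. $\mathrm{TFl}^\circ(4)=\mathrm{Trop}(\mathrm{Fl}^\circ(4))$.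 *)

(* Defs.v *)
From HB Require Import structures.
From mathcomp Require Import all_boot all_order all_algebra.
From mathcomp Require Import finmap.
From mathcomp.multinomials Require Export monalg.
From mathcomp Require Export complex.
From mathcomp Require Export boolp classical_sets reals.

Set Implicit Arguments.
Unset Strict Implicit.
Unset Printing Implicit Defensive.

Import GRing.Theory Num.Theory.

Local Open Scope fset_scope.
Local Open Scope ring_scope.

(* [{malg R[M]}] is a ring only for monoids M without nontrivial units, so the
   group algebra of an additive group M is rebuilt here on the same carrier. *)
Definition galg (M : zmodType) (R : comNzRingType) : Type := {malg R[M]}.

Section GroupAlgebra.
Context (M : zmodType) (R : comNzRingType).
Local Notation S := (galg M R).
Implicit Types (f g h : S) (u v : M).

HB.instance Definition _ := GRing.Lmodule.copy S {malg R[M]}.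

Definition gone : S := << 0 >>.

Definition gmul f g : S :=
  \sum_(u <- msupp f) \sum_(v <- msupp g) << f@_u * g@_v *g u + v >>.

Lemma gmulw (d1 d2 : {fset M}) f g : (msupp f `<=` d1)%fset ->
  (msupp g `<=` d2)%fset ->
  gmul f g = \sum_(u <- d1) \sum_(v <- d2) << f@_u * g@_v *g u + v >>.
Proof.
move=> le_d1 le_d2; rewrite /gmul (big_fset_incl _ le_d1) /=.
  apply/eq_bigr=> u _; apply/big_fset_incl => // v _ /mcoeff_outdom ->.
  by rewrite mulr0 monalgU0.
move=> u _ /mcoeff_outdom fu.
by rewrite big1 => // v _; rewrite fu mul0r monalgU0.
Qed.

Lemma gmulC : commutative gmul.
Proof.
move=> f g; rewrite /gmul exchange_big /=; apply/eq_bigr=> u _.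
by apply/eq_bigr=> v _; rewrite mulrC addrC.
Qed.

Lemma gmul0g : left_zero 0 gmul.
Proof. by move=> g; rewrite /gmul msupp0 big_seq_fset0. Qed.

Lemma gmulUg c u g :
  gmul << c *g u >> g = \sum_(v <- msupp g) << c * g@_v *g u + v >>.
Proof.
rewrite (gmulw msuppU_le (fsubset_refl _)) big_seq_fset1.
by apply/eq_bigr => v _; rewrite mcoeffUU.
Qed.

Lemma gmulUU c1 c2 u1 u2 :
  gmul << c1 *g u1 >> << c2 *g u2 >> = << c1 * c2 *g u1 + u2 >>.
Proof. by rewrite (gmulw msuppU_le msuppU_le) !big_seq_fset1 !mcoeffUU. Qed.

Lemma gmulEl f g :
  gmul f g = \sum_(u <- msupp f) gmul << f@_u *g u >> g.
Proof. by apply/eq_bigr=> u _; rewrite gmulUg. Qed.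

Lemma gmul1g : left_id gone gmul.
Proof.
move=> g; rewrite gmulUg [RHS]monalgE.
by apply/eq_bigr=> u _; rewrite mul1r add0r.
Qed.

Lemma gmulDl : left_distributive gmul +%R.
Proof.
move=> g1 g2 g.
rewrite [in RHS](gmulw (fsubsetUl _ (msupp g2)) (fsubset_refl _)).
rewrite [in RHS](gmulw (fsubsetUr (msupp g1) _) (fsubset_refl _)).
rewrite (gmulw (msuppD_le _ _) (fsubset_refl _)).
rewrite -big_split /=; apply/eq_bigr=> u _.
rewrite -big_split /=; apply/eq_bigr=> v _.
by rewrite mcoeffD mulrDl monalgUD.
Qed.

Lemma gmulDr : right_distributive gmul +%R.
Proof. by move=> g g1 g2; rewrite gmulC gmulDl ![gmul _ g]gmulC. Qed.

Lemma gmulg0 : right_zero 0 gmul.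
Proof. by move=> g; rewrite gmulC gmul0g. Qed.

Lemma gmul_suml (I : Type) (r : seq I) (F : I -> S) g :
  gmul (\sum_(i <- r) F i) g = \sum_(i <- r) gmul (F i) g.
Proof. exact: (big_morph (gmul^~ g) (fun _ _ => gmulDl _ _ _) (gmul0g _)). Qed.

Lemma gmul_sumr (I : Type) (r : seq I) (F : I -> S) g :
  gmul g (\sum_(i <- r) F i) = \sum_(i <- r) gmul g (F i).
Proof. exact: (big_morph (gmul g) (fun _ _ => gmulDr _ _ _) (gmulg0 _)). Qed.

Lemma galgE g : g = \sum_(u <- msupp g) (<< g@_u *g u >> : S).
Proof. exact: (monalgE g). Qed.

Lemma gmulA : associative gmul.
Proof.
move=> f g h; rewrite {1}(galgE f) [in RHS](galgE f).
move: (msupp f) (fun u => f@_u) => sf cf; rewrite !gmul_suml.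
apply/eq_bigr=> u _; rewrite {1}(galgE g) [in RHS](galgE g).
move: (msupp g) (fun v => g@_v) => sg cg.
rewrite gmul_sumr !gmul_suml gmul_sumr; apply/eq_bigr=> v _.
rewrite {1}(galgE h) [in RHS](galgE h).
move: (msupp h) (fun v => h@_v) => sh ch; rewrite !gmul_sumr.
by apply/eq_bigr=> k _; rewrite !gmulUU mulrA addrA.
Qed.

Lemma gone_neq0 : gone != 0.
Proof. by apply/eqP/malgP=> /(_ 0) /eqP; rewrite mcoeffUU mcoeff0 oner_eq0. Qed.

HB.instance Definition _ := GRing.Zmodule_isComNzRing.Build S
  gmulA gmulC gmul1g gmulDl gone_neq0.

Lemma gscaleAl (c : R) f g : c *: (f * g) = (c *: f) * g.
Proof.
have Z (x : S) : c *: x = gmul << c *g 0 >> x.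
  by rewrite gmulUg; apply/eq_bigr => u _; rewrite add0r.
by rewrite !Z; apply: gmulA.
Qed.

HB.instance Definition _ := GRing.Lmodule_isLalgebra.Build R S gscaleAl.
HB.instance Definition _ := GRing.Lalgebra_isComAlgebra.Build R S.

End GroupAlgebra.

Section Ideals.
Context {A : comNzRingType}.

Definition is_ideal (I : set A) : Prop :=
  [/\ I 0, forall x y, I x -> I y -> I (x + y) & forall a x, I x -> I (a * x)].

Definition prime_ideal (P : set A) : Prop :=
  [/\ is_ideal P, ~ P 1 & forall x y, P (x * y) -> P x \/ P y].

Definition ideal_gen (E : set A) : set A := smallest is_ideal E.

(* Closed subset V(E) of Spec A; its points are the prime ideals of A. *)
Definition zero_locus (E : set A) : set (set A) :=
  [set P | prime_ideal P /\ (E `<=` P)%classic].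

(* The space underlying Spec (A / J), which is the subspace V(J) of Spec A, is
   irreducible: nonempty, and not covered by two proper closed subsets. *)
Definition irreducible_quotient (J : set A) : Prop :=
  (zero_locus J !=set0)%classic /\
  forall E1 E2 : set A,
    (zero_locus J `<=` zero_locus E1 `|` zero_locus E2)%classic ->
    (zero_locus J `<=` zero_locus E1)%classic \/
    (zero_locus J `<=` zero_locus E2)%classic.

End Ideals.

(* Infinitesimal lifting for A / J over k: morphisms out of A / J are morphisms
   out of A that vanish on J, and B -> B' is a surjection whose kernel has
   square zero. The zero algebra, which is not a [comAlgType], is omitted
   without loss: if B' = 0 then B = 0 and there is nothing to lift. *)
Definition formally_smooth_quotient (k : comNzRingType) (A : comAlgType k)
    (J : set A) : Prop :=
  forall (B B' : comAlgType k) (pi : {lrmorphism B -> B'}),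
    (forall y : B', exists x : B, pi x = y) ->
    (forall x y : B, pi x = 0 -> pi y = 0 -> x * y = 0) ->
  forall phi : {lrmorphism A -> B'},
    (forall f, J f -> phi f = 0) ->
  exists psi : {lrmorphism A -> B},
    (forall f, J f -> psi f = 0) /\ (forall f, pi (psi f) = phi f).

(* Smoothness of Spec (A / J) over k, in the sense of EGA IV 17.3.1: formally
   smooth and of finite presentation. When A is finitely presented over k, as
   Laurent polynomial rings are, the latter means that J is finitely
   generated. *)
Definition smooth_quotient (k : comNzRingType) (A : comAlgType k)
    (J : set A) : Prop :=
  (exists s : seq A, J = ideal_gen [set` s]) /\ formally_smooth_quotient J.

(* Indices of the Plücker coordinates of Fl(n). *)
Definition pidx (n : nat) : finType := {A : {set 'I_n} | (0 < #|A| < n)%N}.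

(* Characters of the torus prod_j G_m^{binom([n],j)} / G_m: exponent vectors
   whose entries sum to 0 in each of the n - 1 blocks. *)
Definition deg0 (n : nat) : {pred {ffun pidx n -> int}} :=
  fun u => [forall j : 'I_n, \sum_(A : pidx n | #|val A| == j) u A == 0].

Lemma deg0_zmod_closed (n : nat) : zmod_closed (@deg0 n).
Proof.
split=> [|u v /forallP du /forallP dv]; apply/forallP => j.
  by rewrite big1 // => A _; rewrite ffunE.
under eq_bigr do rewrite !ffunE.
by rewrite sumrB (eqP (du j)) (eqP (dv j)) subrr.
Qed.

HB.instance Definition _ (n : nat) :=
  GRing.isZmodClosed.Build {ffun pidx n -> int} (@deg0 n) (@deg0_zmod_closed n).

Record character (n : nat) : Type := Character {
  exponent :> {ffun pidx n -> int};
  _ : exponent \in @deg0 n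
}.

HB.instance Definition _ (n : nat) := [isSub for @exponent n].
HB.instance Definition _ (n : nat) := [Choice of character n by <:].
HB.instance Definition _ (n : nat) :=
  [SubChoice_isSubZmodule of character n by <:].

(* Coordinate ring of the torus. *)
Notation laurent n K := (galg (character n) K).

Section Tropical.
Context (R : realType) (n : nat).
Local Notation S := (laurent n R[i]).

(* A real cocharacter, an element of prod_j R^{binom([n],j)} / R1, is given by a
   representative w; by [pairing_shift] only its class matters. *)
Definition pairing (u : character n) (w : pidx n -> R) : R :=
  \sum_A (u A)%:~R * w A.

Lemma pairing_shift (u : character n) (w : pidx n -> R) (c : nat -> R) :
  pairing u (fun A => w A + c #|val A|) = pairing u w.
Proof.
rewrite /pairing; under eq_bigr do rewrite mulrDr.
rewrite big_split /= -[RHS]addr0; congr (_ + _).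
have lt_n (A : pidx n) : (#|val A| < n)%N by case/andP: (valP A).
rewrite (partition_big (fun A => Ordinal (lt_n A)) xpredT) //= big1 // => j _.
have /forallP/(_ j)/eqP du := valP u.
rewrite (eq_bigr (fun A => (u A)%:~R * c j)) => [|A /eqP <- //].
by rewrite -mulr_suml -raddf_sum /= du mul0r.
Qed.

Definition initial_form (w : pidx n -> R) (f : S) : S :=
  \sum_(u <- msupp f | all (fun v => pairing u w <= pairing v w) (msupp f))
     << f@_u *g u >>.

Definition initial_ideal (w : pidx n -> R) (I : set S) : set S :=
  ideal_gen [set initial_form w f | f in I]%classic.

Definition Trop (I : set S) : set (pidx n -> R) :=
  [set w | initial_ideal w I <> ideal_gen [set 1]]%classic.

(* Bases (as rows of B j) of the members of a complete flag
   F_1 < ... < F_(n-1) in C^n, where F_j is the row space of B j. *)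
Definition flag_bases (B : forall j : nat, 'M[R[i]]_(j, n)) : Prop :=
  (forall j, (0 < j < n)%N -> row_free (B j)) /\
  (forall i j, (0 < i <= j)%N -> (j < n)%N -> (B i <= B j)%MS).

Definition plucker (B : forall j : nat, 'M[R[i]]_(j, n)) (A : pidx n) : R[i] :=
  \det (colsub (@enum_val _ (val A)) (B #|val A|)).

(* All representatives, in the affine cones, of the points of Fl(n) whose
   Plücker coordinates are all nonzero. *)
Definition open_flag : set (pidx n -> R[i]) :=
  [set p | (exists2 B, flag_bases B & p = plucker B) /\ forall A, p A != 0]%classic.

Definition eval (p : pidx n -> R[i]) (f : S) : R[i] :=
  \sum_(u <- msupp f) f@_u * \prod_A p A ^ u A.

Definition open_flag_ideal : set S :=
  [set f | forall p, open_flag p -> eval p f = 0]%classic.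

End Tropical.

(* Main.v *)
Require Import Defs.
From mathcomp Require Import all_boot all_order all_algebra.
From mathcomp Require Import complex boolp classical_sets reals.
From HB Require Import structures.
From mathcomp Require Import finmap ring zify.
From mathcomp Require Import topology normedtype sequences exp.

(** The open flag variety of four-space is the complement of a hyperplane
    arrangement. A flag with nonvanishing Plücker coordinates consists of a line
    of projective space with four distinct marked points, cut out by the
    coordinate hyperplanes, of the point [F_1] on it away from these, and of the
    dual datum [F_3], which amounts to another such point; up to the action of
    the diagonal torus, these are two points, possibly equal, on a line with four
    marked points removed. With one marked point at infinity, the differences of
    the affine coordinates between marked points, and between a marked point and
    either of the two others, are proportional to Laurent monomials in the
    Plücker coordinates. Together with two further monomials they form a basis of
    the character lattice of the torus ([flag4_basis]), and in these eleven
    coordinates the open flag variety is the part of a linear space of dimension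
    6 where no coordinate vanishes ([open_flag_idealE]): the three-term Plücker
    relations become linear, and conversely a point of the linear space is
    realized by an explicit flag.

    The theorem thus follows from the fact that initial degenerations of linear
    spaces are linear ([linear_initial_degenerations]). Choose a basis of
    coordinates of maximal weight ([max_weight_basis]). Each other coordinate is
    then a linear form in basis coordinates of at least its own weight, so that
    the initial form of this relation expresses it again through the basis
    coordinates. The initial ideal is generated by these relations: a limit
    along the one-parameter degeneration shows that initial forms of elements of
    the ideal vanish on the complement of the new arrangement
    ([init_form_vanishing]), and a function that vanishes there is a combination
    of the relations ([vanishing_graph]). The quotient is therefore a
    localization of a polynomial ring: formally smooth because the free variables
    can be lifted ([graph_formally_smooth]), and irreducible because the
    vanishing ideal is prime, as one sees by restricting functions to lines
    ([arr_compl_prime]). *)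

Set Implicit Arguments.
Unset Strict Implicit.
Unset Printing Implicit Defensive.

Import Order.TTheory GRing.Theory Num.Theory.
Import numFieldNormedType.Exports.

Local Open Scope ring_scope.

(** * Algebra morphisms out of a group algebra *)

Section Monomials.
Context (M : zmodType) (K : comNzRingType).
Local Notation S := (galg M K).

Definition mono (u : M) : S := << 1 *g u >>.

Lemma mcoeff_mono u v : (mono u)@_v = (u == v)%:R.
Proof. exact: mcoeffU. Qed.

Lemma mono0 : mono 0 = 1. Proof. by []. Qed.

Lemma monoD u v : mono (u + v) = mono u * mono v.
Proof. by have := @gmulUU M K 1 1 u v; rewrite mulr1. Qed.

Lemma monoNK u : mono (- u) * mono u = 1.
Proof. by rewrite -monoD addNr. Qed.

Lemma scale_mono c u : c *: mono u = << c *g u >>.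
Proof.
apply/malgP => v; rewrite mcoeffZ !mcoeffU.
by case: eqP; rewrite ?mulr1n ?mulr0n ?mulr0 ?mulr1.
Qed.

Lemma galg_mono (f : S) : f = \sum_(u <- msupp f) f@_u *: mono u.
Proof. by rewrite {1}[f]galgE; apply: eq_bigr => u _; rewrite scale_mono. Qed.

End Monomials.

Section Extension.
Context (M : zmodType) (K : comNzRingType) (B : comAlgType K) (g : M -> B).
Local Notation S := (galg M K).

(** Universal property of the group algebra: an algebra morphism out of it is the
    same as a map [g] from [M] to the units, turning sums into products. *)
Definition galg_ext (f : S) : B := \sum_(u <- msupp f) f@_u *: g u.

Lemma galg_extEw (d : {fset M}) (f : S) : (msupp f `<=` d)%fset ->
  galg_ext f = \sum_(u <- d) f@_u *: g u.
Proof.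
move=> le_d; rewrite /galg_ext (big_fset_incl _ le_d) //= => u _ /mcoeff_outdom ->.
by rewrite scale0r.
Qed.

Lemma galg_ext_is_linear : linear galg_ext.
Proof.
move=> a x y.
have le1 : (msupp (a *: x + y) `<=` msupp x `|` msupp y)%fset.
  apply: fsubset_trans (msuppD_le _ _) _; apply: fsetUSS; last exact: fsubset_refl.
  exact: msuppZ_le.
rewrite (galg_extEw le1) (galg_extEw (fsubsetUl (msupp x) (msupp y))).
rewrite (galg_extEw (fsubsetUr (msupp x) (msupp y))).
rewrite scaler_sumr -big_split /=; apply: eq_bigr => u _.
by rewrite mcoeffD mcoeffZ scalerDl scalerA.
Qed.

HB.instance Definition _ := GRing.isLinear.Build K S B _ galg_ext galg_ext_is_linear.

Lemma galg_ext_mono u : galg_ext (mono K u) = g u.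
Proof.
rewrite (galg_extEw msuppU_le) big_seq_fset1 mcoeffUU scale1r //.
Qed.

Context (g0 : g 0 = 1) (gD : forall u v, g (u + v) = g u * g v).

Lemma galg_ext_is_monoid_morphism : monoid_morphism galg_ext.
Proof.
split=> [|x y]; first by rewrite -mono0 galg_ext_mono.
have -> : x * y = \sum_(u <- msupp x) \sum_(v <- msupp y)
    (x@_u * y@_v) *: mono K (u + v).
  rewrite {1}[x]galg_mono {1}[y]galg_mono mulr_suml.
  apply: eq_bigr => u _; rewrite mulr_sumr; apply: eq_bigr => v _.
  by rewrite monoD -scalerAl -scalerAr scalerA.
rewrite linear_sum [RHS]mulr_suml; apply: eq_bigr => u _.
rewrite linear_sum [RHS]mulr_sumr; apply: eq_bigr => v _.
by rewrite linearZ /= galg_ext_mono gD -scalerAl -scalerAr scalerA.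
Qed.
End Extension.

Definition galg_ext_lrmorphism (M : zmodType) (K : comNzRingType) (B : comAlgType K)
  (g : M -> B) (g0 : g 0 = 1) (gD : forall u v, g (u + v) = g u * g v) :
  {lrmorphism galg M K -> B} :=
  HB.pack (galg_ext g) (GRing.isLinear.Build K (galg M K) B _ _ (galg_ext_is_linear g))
   (GRing.isMonoidMorphism.Build (galg M K) B _ (galg_ext_is_monoid_morphism g0 gD)).

(** * Coordinates on a torus *)

Section IntegerPowers.
Context (B : comNzRingType).

(** Integer power of a unit [b] with chosen inverse [c]. The algebras met below
    carry no decidable notion of unit, so the inverse is part of the data. *)
Definition zpow (b c : B) (m : int) : B :=
  match m with Posz k => b ^+ k | Negz k => c ^+ k.+1 end.

Lemma zpowS b c m : b * c = 1 -> zpow b c (m + 1) = zpow b c m * b.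
Proof.
move=> bc; case: m => [k|[|k]].
- have -> : Posz k + 1 = Posz k.+1 by lia.
  by rewrite /= exprSr.
- by rewrite /= expr1 mulrC bc.
- have -> : Negz k.+1 + 1 = Negz k :> int by rewrite !NegzE; lia.
  by rewrite /= [c ^+ k.+2]exprS mulrAC [c * b]mulrC bc mul1r.
Qed.

Lemma zpow_pred b c m : b * c = 1 -> zpow b c (m - 1) = zpow b c m * c.
Proof.
move=> bc; rewrite -[X in _ = zpow _ _ X * _](subrK 1) zpowS // -mulrA bc.
by rewrite mulr1.
Qed.

Lemma zpowD b c m k : b * c = 1 -> zpow b c (m + k) = zpow b c m * zpow b c k.
Proof.
move=> bc; elim/int_rect: k => [|k IH|k IH].
- by rewrite addr0 mulr1.
- have -> : m + k.+1%:Z = m + k%:Z + 1 by lia.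
  have -> : k.+1%:Z = k%:Z + 1 by lia.
  by rewrite !zpowS // IH mulrA.
- have -> : m - k.+1%:Z = m - k%:Z - 1 by lia.
  have -> : - k.+1%:Z = - k%:Z - 1 by lia.
  by rewrite !zpow_pred // IH mulrA.
Qed.

End IntegerPowers.

Lemma zpowV (K : fieldType) (z : K) m : zpow z z^-1 m = z ^ m.
Proof. by case: m => k //=; rewrite NegzE exprVn. Qed.

Lemma rmorph_zpow (B B' : comNzRingType) (h : {rmorphism B -> B'}) b c m :
  h (zpow b c m) = zpow (h b) (h c) m.
Proof. by case: m => k /=; rewrite rmorphXn. Qed.

Lemma additive_mulrz (M N : zmodType) (f : M -> N) :
  (forall u v, f (u + v) = f u + f v) -> forall u m, f (u *~ m) = f u *~ m.
Proof.
move=> fD; have f0 : f 0 = 0 by apply: (addrI (f 0)); rewrite -fD !addr0.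
have fN v : f (- v) = - f v by apply: (addrI (f v)); rewrite -fD !subrr.
have fX v k : f (v *+ k) = f v *+ k.
  by elim: k => [|k IH]; rewrite ?mulr0n // !mulrS fD IH.
by move=> u [] k; rewrite ?NegzE -?pmulrn ?nmulrn ?fN fX.
Qed.

(** A basis of the lattice [M] together with its dual basis of coordinates. It
    identifies the spectrum of the group algebra of [M] with [G_m^n], so that
    points of the torus become row vectors with nonzero entries. *)
Record lattice_basis (M : zmodType) (n : nat) := LatticeBasis {
  bvec : 'I_n -> M;
  bcoord : M -> 'I_n -> int;
  bcoordD : forall u v e, bcoord (u + v) e = bcoord u e + bcoord v e;
  bcoord_bvec : forall i e, bcoord (bvec i) e = (i == e)%:R;
  bcoordK : forall u, u = \sum_e bvec e *~ bcoord u e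
}.

Section TorusPoints.
Context (M : zmodType) (n : nat) (bs : lattice_basis M n).
Local Notation chi := (bvec bs).
Local Notation crd := (bcoord bs).

Lemma bcoord0 e : crd 0 e = 0.
Proof. by have := bcoordD bs 0 0 e; rewrite addr0; lia. Qed.

Lemma bcoordMz u m e : crd (u *~ m) e = crd u e * m.
Proof.
by rewrite (additive_mulrz (fun u v => bcoordD bs u v e)) mulrzz.
Qed.

Lemma bcoord_sum I (r : seq I) (F : I -> M) e :
  crd (\sum_(i <- r) F i) e = \sum_(i <- r) crd (F i) e.
Proof.
apply: (big_morph (crd^~ e)) => [u v|]; [exact: bcoordD | exact: bcoord0].
Qed.

Lemma bcoord_inj u v : crd u =1 crd v -> u = v.
Proof.
by move=> uv; rewrite (bcoordK bs u) (bcoordK bs v); apply: eq_bigr => e _; rewrite uv.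
Qed.

Section CharPow.
Context (B : comNzRingType) (q q' : 'I_n -> B).

Definition char_pow (u : M) : B := \prod_e zpow (q e) (q' e) (crd u e).

Lemma char_pow0 : char_pow 0 = 1.
Proof. by rewrite /char_pow big1 // => e _; rewrite bcoord0. Qed.

Context (qK : forall e, q e * q' e = 1).

Lemma char_powD u v : char_pow (u + v) = char_pow u * char_pow v.
Proof.
rewrite /char_pow -big_split /=; apply: eq_bigr => e _.
by rewrite bcoordD zpowD.
Qed.

Lemma char_pow_chi e : char_pow (chi e) = q e.
Proof.
rewrite /char_pow (bigD1 e) //= bcoord_bvec eqxx big1 ?mulr1 // => i ne.
by rewrite bcoord_bvec eq_sym (negbTE ne).
Qed.
End CharPow.

(** A monomial is the product of powers of the basis monomials; hence an algebra
    morphism is determined by the images of the latter. *)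
Lemma char_pow_mono (K : comNzRingType) u :
  char_pow (fun e => mono K (chi e)) (fun e => mono K (- chi e)) u = mono K u.
Proof.
have zp v m : zpow (mono K v) (mono K (- v)) m = mono K (v *~ m).
  have E k : mono K v ^+ k = mono K (v *+ k).
    by elim: k => // k IH; rewrite exprS mulrS monoD IH.
  have E' k : mono K (- v) ^+ k = mono K (v *- k).
    elim: k => [|k IH]; first by rewrite mulr0n oppr0.
    by rewrite exprS mulrS opprD monoD IH.
  by case: m => k /=; rewrite ?E ?E'.
rewrite {2}(bcoordK bs u) /char_pow.
rewrite (big_morph (mono K) (@monoD M K) (mono0 M K)).
by apply: eq_bigr => e _; rewrite zp.
Qed.

Lemma lrmorph_mono (K : comNzRingType) (B : comAlgType K)
    (h : {lrmorphism galg M K -> B}) u :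
  h (mono K u) =
  char_pow (fun e => h (mono K (chi e))) (fun e => h (mono K (- chi e))) u.
Proof.
rewrite -{1}char_pow_mono rmorph_prod; apply: eq_bigr => e _.
exact: rmorph_zpow.
Qed.

Section Evaluation.
Context (K : numFieldType).
Local Notation S := (galg M K).
Implicit Types (z : 'rV[K]_n) (f g : S).

Definition in_torus z := forall e, z 0 e != 0.

Definition chr z u : K := \prod_e z 0 e ^ crd u e.

Definition ev z f : K := \sum_(u <- msupp f) f@_u * chr z u.

Lemma chr0 z : chr z 0 = 1.
Proof. by rewrite /chr big1 // => e _; rewrite bcoord0. Qed.

Lemma chrE z u : chr z u = char_pow (fun e => z 0 e) (fun e => (z 0 e)^-1) u.
Proof. by apply: eq_bigr => e _; rewrite zpowV. Qed.

Lemma chrD z u v : in_torus z -> chr z (u + v) = chr z u * chr z v.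
Proof. by move=> z0; rewrite !chrE char_powD // => e; rewrite mulfV. Qed.

Lemma chr_chi z e : chr z (chi e) = z 0 e.
Proof. by rewrite chrE char_pow_chi. Qed.

Lemma chr_neq0 z u : in_torus z -> chr z u != 0.
Proof. by move=> z0; apply/prodf_neq0 => e _; rewrite expfz_neq0. Qed.

Lemma ev_is_linear z : linear (ev z : S -> K^o).
Proof. exact: (@galg_ext_is_linear M K K^o (chr z)). Qed.
HB.instance Definition _ z := GRing.isLinear.Build K S K^o _ (ev z) (ev_is_linear z).

Lemma evZ z a f : ev z (a *: f) = a * ev z f.
Proof. exact: linearZ. Qed.

Lemma ev_mono z u : ev z (mono K u) = chr z u.
Proof. exact: (@galg_ext_mono M K K^o). Qed.

Lemma ev1 z : ev z 1 = 1. Proof. by rewrite -mono0 ev_mono chr0. Qed.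

Lemma evM z f g : in_torus z -> ev z (f * g) = ev z f * ev z g.
Proof.
move=> z0; have chrzD u v : chr z (u + v) = chr z u * chr z v by exact: chrD.
exact: (@galg_ext_is_monoid_morphism M K K^o (chr z) (chr0 z) chrzD).2 f g.
Qed.
End Evaluation.
End TorusPoints.

(** * Vanishing ideals of arrangement complements *)

Section FunctionsOnTorus.
Context (M : zmodType) (n : nat) (bs : lattice_basis M n) (K : numFieldType).
Local Notation S := (galg M K).
Local Notation chi := (bvec bs).
Local Notation crd := (bcoord bs).
Implicit Types (z : 'rV[K]_n) (f g : S).

(** Distinct characters of the torus are linearly independent (Artin). If [u1] is in
    the support of a vanishing [f] and [z0] is a point, then
    [f (z z0) - z0^u1 f z] vanishes as well and no longer involves [u1]. By
    induction all its coefficients are zero, for every [z0]; as points with a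
    coordinate 2 separate the exponents, [f] has a single term, and its value at
    the unit point is its coefficient. *)
Lemma ev_torus_eq0 f : (forall z, in_torus z -> ev bs z f = 0) -> f = 0.
Proof.
have [k] := ubnP #|` msupp f|; elim: k f => // k IH f ltk f0.
apply: contrapT => fn0; have /fset0Pn [u1 u1f] : msupp f != fset0.
  by apply/eqP => s0; apply: fn0; rewrite [f]galg_mono s0 big_seq_fset0.
pose D z0 : S := galg_ext (fun u => (chr bs z0 u - chr bs z0 u1) *: mono K u) f.
have DE z0 u : (D z0)@_u = f@_u * (chr bs z0 u - chr bs z0 u1).
  rewrite /D /galg_ext raddf_sum /=.
  under eq_bigr do rewrite !mcoeffZ mcoeff_mono.
  have [uf|uf] := boolP (u \in msupp f).
    rewrite (big_fsetD1 u) //= eqxx mulr1 big1_fset ?addr0 // => v.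
    by rewrite in_fsetD1 => /andP[/negbTE ->]; rewrite !mulr0.
  rewrite (mcoeff_outdom uf) mul0r big1_fset // => v vf _.
  by case: eqP uf vf => [<- /negbTE ->|_ _ _] //; rewrite !mulr0.
have chrM z z0 u : chr bs (\row_e (z 0 e * z0 0 e)) u = chr bs z u * chr bs z0 u.
  rewrite /chr -big_split /=; apply: eq_bigr => e _.
  by rewrite mxE expfzMl.
have supD z0 : (msupp (D z0) `<=` msupp f `\ u1)%fset.
  apply/fsubsetP => u; rewrite -mcoeff_neq0 DE mulf_eq0 negb_or subr_eq0.
  rewrite mcoeff_neq0 in_fsetD1 => /andP[-> ne]; rewrite andbT.
  by apply: contraNneq ne => ->.
have D0 z0 : in_torus z0 -> D z0 = 0.
  move=> z0P; apply: IH => [|z zP].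
    apply: leq_ltn_trans (fsubset_leq_card (supD z0)) _.
    by move: ltk; rewrite (cardfsD1 u1) u1f add1n ltnS.
  have -> : ev bs z (D z0) =
      ev bs (\row_e (z 0 e * z0 0 e)) f - chr bs z0 u1 * ev bs z f.
    rewrite /D /galg_ext linear_sum mulr_sumr -sumrB /=; apply: eq_bigr => u _.
    rewrite !evZ ev_mono chrM; ring.
  by rewrite !f0 ?mulr0 ?subrr // => e; rewrite mxE mulf_neq0.
have u1_only u : u \in msupp f -> u = u1.
  move=> uf; apply: (bcoord_inj (bs := bs)) => e.
  pose z0 : 'rV[K]_n := \row_i (if i == e then 2 else 1).
  have z0P : in_torus z0.
    by move=> i; rewrite mxE; case: ifP => _; rewrite ?oner_neq0 ?pnatr_eq0.
  have cz v : chr bs z0 v = 2 ^ crd v e.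
    rewrite /chr (bigD1 e) //= mxE eqxx big1 ?mulr1 // => i /negbTE ie.
    by rewrite mxE ie exp1rz.
  have /eqP := DE z0 u; rewrite D0 // mcoeff0 eq_sym mulf_eq0 mcoeff_eq0 uf /=.
  (* Integer powers of 2 are compared in the rational numbers, which are real. *)
  have two m : 2 ^ m = ratr (2 ^ m) :> K by rewrite fmorphXz /= ratr_nat.
  rewrite subr_eq0 !cz !two (inj_eq (fmorph_inj _)) => /eqP.
  exact: ieexprIz.
have fE : msupp f = [fset u1]%fset.
  apply/fsetP => u; rewrite in_fset1; apply/idP/eqP => [|-> //]; exact: u1_only.
have T1 : in_torus (const_mx 1 : 'rV[K]_n) by move=> e; rewrite mxE oner_eq0.
have /eqP := f0 _ T1; rewrite /ev fE big_seq_fset1 mulf_eq0.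
by rewrite mcoeff_eq0 u1f (negbTE (chr_neq0 _ _ T1)).
Qed.

End FunctionsOnTorus.

Section VanishingIdeals.
Context (M : zmodType) (n : nat) (bs : lattice_basis M n) (K : numFieldType).
Local Notation S := (galg M K).
Local Notation chi := (bvec bs).
Local Notation crd := (bcoord bs).
Implicit Types (z : 'rV[K]_n) (f g : S).

Definition vanishing (Y : set 'rV[K]_n) : set S :=
  [set f | forall z, Y z -> ev bs z f = 0]%classic.

(** Complement of the coordinate hyperplanes in the row space of [V], that is, of
    a hyperplane arrangement in a linear space. *)
Definition arr_compl r (V : 'M[K]_(r, n)) : set 'rV[K]_n :=
  [set z | in_torus z /\ (z <= V)%MS]%classic.

(** Multiplication by the monomial of exponent [v] turns [f] into an honest
    polynomial in the basis monomials. *)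
Definition clears (v : M) f := forall u e, u \in msupp f -> 0 <= crd (u + v) e.

Lemma exists_clears f : exists v, clears v f.
Proof.
(* [N] bounds all the negative exponents. *)
pose N : nat := \sum_(u <- msupp f) \sum_e `|crd u e|%N.
exists (\sum_e chi e *~ N) => u e uf; rewrite bcoordD bcoord_sum.
rewrite (bigD1 e) //= bcoordMz bcoord_bvec eqxx big1 => [|i /negbTE ne]; last first.
  by rewrite bcoordMz bcoord_bvec ne mul0r.
have : (`|crd u e|%N <= N)%N.
  by rewrite /N (big_fsetD1 u) //= (bigD1 e) //= -addnA leq_addr.
rewrite mul1r addr0; lia.
Qed.

Lemma chr_clears z v u : (forall e, 0 <= crd (u + v) e) -> in_torus z ->
  \prod_e z 0 e ^+ `|crd (u + v) e| = chr bs z v * chr bs z u.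
Proof.
move=> ge0 zT; rewrite -chrD // [v + u]addrC; apply: eq_bigr => e _.
by move: (ge0 e); case: (crd _ e).
Qed.

Lemma vanishing_is_ideal Y : (forall z, Y z -> in_torus z) -> is_ideal (vanishing Y).
Proof.
move=> YT; split=> [z _|x y x0 y0 z Yz|a x x0 z Yz]; first by rewrite linear0.
  by rewrite linearD /= x0 // y0 // addr0.
by rewrite evM ?x0 ?mulr0 //; exact: YT.
Qed.

Lemma exists_nonroot (p : {poly K}) : p != 0 -> exists s, p.[s] != 0.
Proof.
move=> p0; apply: contrapT => H.
have inj : injective (fun i : nat => i%:R : K).
  by move=> i j /eqP; rewrite eqr_nat => /eqP.
have := @max_poly_roots K p [seq i%:R | i <- iota 0 (size p)] p0.
rewrite size_map size_iota ltnn map_inj_uniq // iota_uniq => /(_ _ isT).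
have -> : all (root p) [seq i%:R | i <- iota 0 (size p)] by
  apply/allP => s _; apply: contrapT => /negP sp; apply: H; exists s.
by move=> /(_ isT).
Qed.

(** If [f] does not vanish at [z1] nor [g] at [z2], restrict both to the line
    through these two points: up to monomial factors they become nonzero
    univariate polynomials, and so do the coordinates. A point of the line that
    avoids the finitely many roots lies in the complement, and [f * g] does not
    vanish there. *)
Lemma arr_compl_prime r (V : 'M[K]_(r, n)) :
  (arr_compl V !=set0)%classic -> prime_ideal (vanishing (arr_compl V)).
Proof.
move=> [z0 [z0T z0V]]; split.
- by apply: vanishing_is_ideal => z [].
- by move=> /(_ z0 (conj z0T z0V)); rewrite ev1 => /eqP; rewrite oner_eq0.
move=> f g fg0; apply: contrapT => /not_orP [/existsNP [z1 nf] /existsNP [z2 ng]].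
have {nf} [[z1T z1V] /eqP f1] := (not_implyP _ _).1 nf.
have {ng} [[z2T z2V] /eqP g2] := (not_implyP _ _).1 ng.
pose l e : {poly K} := (z1 0 e)%:P + (z2 0 e - z1 0 e) *: 'X.
have lE e s : (l e).[s] = (z1 + s *: (z2 - z1)) 0 e.
  by rewrite /l !hornerE !mxE; ring.
pose F v h : {poly K} := \sum_(u <- msupp h) h@_u *: \prod_e l e ^+ `|crd (u + v) e|.
have FE v h s : clears v h -> in_torus (z1 + s *: (z2 - z1)) ->
    (F v h).[s] = chr bs (z1 + s *: (z2 - z1)) v * ev bs (z1 + s *: (z2 - z1)) h.
  move=> cl zT; rewrite /F horner_sum /ev mulr_sumr big_seq [RHS]big_seq.
  apply: eq_bigr => u uh; rewrite hornerZ horner_prod mulrCA; congr (_ * _).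
  rewrite -chr_clears //; last by move=> e; exact: cl.
  by apply: eq_bigr => e _; rewrite horner_exp lE.
have [v vf] := exists_clears f; have [v' vg] := exists_clears g.
have at0 : z1 + 0 *: (z2 - z1) = z1 by rewrite scale0r addr0.
have at1 : z1 + 1 *: (z2 - z1) = z2 by rewrite scale1r addrC subrK.
have F0 : F v f != 0.
  apply: contraNneq (mulf_neq0 (chr_neq0 bs v z1T) f1) => F0.
  by rewrite -{1 2}at0 -FE ?at0 // F0 horner0.
have G0 : F v' g != 0.
  apply: contraNneq (mulf_neq0 (chr_neq0 bs v' z2T) g2) => G0.
  by rewrite -{1 2}at1 -FE ?at1 // G0 horner0.
have L0 : \prod_e l e != 0.
  apply/prodf_neq0 => e _; apply: contraNneq (z1T e) => l0.
  by rewrite -at0 -lE l0 horner0.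
have [s] := exists_nonroot (mulf_neq0 (mulf_neq0 F0 G0) L0).
rewrite !hornerM !mulf_eq0 !negb_or horner_prod => /andP[/andP[Fs Gs] Ls].
have sT : in_torus (z1 + s *: (z2 - z1)).
  by move=> e; rewrite -lE; move/prodf_neq0: Ls; apply.
have sV : ((z1 + s *: (z2 - z1))%R <= V)%MS.
  by rewrite addmx_sub // scalemx_sub // addmx_sub // eqmx_opp.
move: Fs Gs; rewrite !FE // !mulf_eq0 !negb_or => /andP[_ fs] /andP[_ gs].
by have /eqP := fg0 _ (conj sT sV); rewrite evM // mulf_eq0 (negbTE fs) (negbTE gs).
Qed.

(** The torus is itself an arrangement complement, whose vanishing ideal is prime
    and, by independence of characters, zero. *)
Lemma galg_mul_eq0 f g : f * g = 0 -> g <> 0 -> f = 0.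
Proof.
move=> fg g0.
have T1 : in_torus (const_mx 1 : 'rV[K]_n) by move=> e; rewrite mxE oner_eq0.
have torusE : arr_compl (1%:M : 'M[K]_n) = [set z | in_torus z]%classic.
  by apply/seteqP; split=> z; [case | move=> zT; split=> //; exact: submx1].
have [] := @arr_compl_prime _ 1%:M; first by exists (const_mx 1); rewrite torusE.
move=> _ _ /(_ f g) []; rewrite torusE.
- by move=> z _; rewrite fg linear0.
- exact: ev_torus_eq0.
- by move=> H; case: g0; exact: ev_torus_eq0 H.
Qed.

End VanishingIdeals.

(** A prime is the generic point of its own zero locus. *)
Lemma prime_irreducible (A : comNzRingType) (P : set A) :
  prime_ideal P -> irreducible_quotient P.
Proof.
move=> pP; have PP : zero_locus P P by split=> // x.
split; first by exists P.
by move=> E1 E2 /(_ _ PP) [] [_ EP]; [left|right] => Q [pQ PQ]; split=> // x /EP /PQ.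
Qed.

(** * Linear ideals in the group algebra *)

Section IdealGen.
Context (A : comNzRingType).
Implicit Types (E I : set A).

Lemma ideal_gen_ideal E : is_ideal (ideal_gen E).
Proof.
split=> [I [[I0 _ _] _]|x y Ex Ey I HI|a x Ex I HI] //.
  by have [[_ ID _] _] := HI; apply: ID; [exact: Ex | exact: Ey].
by have [[_ _ IM] _] := HI; apply: IM; exact: Ex.
Qed.

Lemma mem_ideal_gen E x : E x -> ideal_gen E x.
Proof. by move=> Ex I [_]; exact. Qed.

Lemma ideal_gen_min E I : is_ideal I -> (E `<=` I)%classic ->
  (ideal_gen E `<=` I)%classic.
Proof. by move=> iI EI x; exact. Qed.

Section Closure.
Context (I : set A) (iI : is_ideal I).

Lemma ideal0 : I 0. Proof. by case: iI. Qed.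
Lemma idealD x y : I x -> I y -> I (x + y). Proof. by case: iI => _ + _; exact. Qed.
Lemma idealMl a x : I x -> I (a * x). Proof. by case: iI => _ _; exact. Qed.

Lemma ideal_sum T (r : seq T) (P : pred T) F :
  (forall i, P i -> I (F i)) -> I (\sum_(i <- r | P i) F i).
Proof. move=> H; apply: big_ind => //; [exact: ideal0 | exact: idealD]. Qed.

Lemma ideal_congM x x' y y' : I (x - y) -> I (x' - y') -> I (x * x' - y * y').
Proof.
move=> h h'; have -> : x * x' - y * y' = x' * (x - y) + y * (x' - y') by ring.
by apply: idealD; apply: idealMl.
Qed.

Lemma ideal_congX x y k : I (x - y) -> I (x ^+ k - y ^+ k).
Proof.
move=> h; elim: k => [|k IH]; first by rewrite subrr; exact: ideal0.
by rewrite !exprS; exact: ideal_congM.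
Qed.

Lemma ideal_cong_prod T (r : seq T) (P : pred T) F G :
  (forall i, P i -> I (F i - G i)) ->
  I (\prod_(i <- r | P i) F i - \prod_(i <- r | P i) G i).
Proof.
move=> H; apply: (big_ind2 (fun x y => I (x - y))) => //.
  by rewrite subrr; exact: ideal0.
by move=> *; exact: ideal_congM.
Qed.
End Closure.
End IdealGen.

(** A lift of a unit along a square-zero extension is a unit: if [x * y = 1 + d]
    with [d^2 = 0], then [y * (1 - d)] is the inverse. *)
Lemma unit_lift (C C' : comNzRingType) (pi : {rmorphism C -> C'}) (x y : C) :
  (forall x y, pi x = 0 -> pi y = 0 -> x * y = 0) -> pi x * pi y = 1 ->
  exists y', x * y' = 1 /\ pi y' = pi y.
Proof.
move=> nil xy1; pose d := x * y - 1.
have pd : pi d = 0 by rewrite rmorphB rmorphM rmorph1 xy1 subrr.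
exists (y * (1 - d)); split; last by rewrite rmorphM rmorphB rmorph1 pd subr0 mulr1.
have -> : x * (y * (1 - d)) = 1 - d * d by rewrite /d; ring.
by rewrite nil // subr0.
Qed.

Section GraphIdeal.
Context (M : zmodType) (n : nat) (bs : lattice_basis M n) (K : numFieldType).
Local Notation S := (galg M K).
Local Notation chi := (bvec bs).
Local Notation crd := (bcoord bs).
Context (r : nat) (B : 'I_r -> 'I_n) (L : 'M[K]_(r, n)).
Context (LB : forall b b', L b (B b') = (b == b')%:R).

(** For the columns chosen by [B] the matrix [L] is the identity, so its row space
    is the graph of a linear map: coordinate [e] is this linear form in the
    coordinates [B b]. *)
Definition lform (e : 'I_n) : S := \sum_b L b e *: mono K (chi (B b)).

Definition graph_gens : seq S := [seq mono K (chi e) - lform e | e <- enum 'I_n].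

Lemma sub_graph (z : 'rV[K]_n) :
  (z <= L)%MS <-> forall e, z 0 e = \sum_b L b e * z 0 (B b).
Proof.
split=> [/submxP[y ->] e|zE].
  rewrite mxE; apply: eq_bigr => b _; rewrite mxE mulrC; congr (_ * _).
  rewrite (bigD1 b) //= LB eqxx mulr1 big1 ?addr0 // => b' ne.
  by rewrite LB (negbTE ne) mulr0.
apply/submxP; exists (\row_b z 0 (B b)); apply/rowP => e.
by rewrite mxE zE; apply: eq_bigr => b _; rewrite mxE mulrC.
Qed.

Lemma graph_row_free : row_free L.
Proof.
apply: inj_row_free => y y0; apply/rowP => b; rewrite [RHS]mxE.
move/rowP/(_ (B b)): y0; rewrite !mxE (bigD1 b) //= LB eqxx mulr1.
rewrite big1 ?addr0 // => b' ne; by rewrite LB (negbTE ne) mulr0.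
Qed.

Lemma ev_lform z e : ev bs z (lform e) = \sum_b L b e * z 0 (B b).
Proof.
rewrite /lform linear_sum /=; apply: eq_bigr => b _.
by rewrite evZ ev_mono chr_chi.
Qed.

Lemma graph_gens_vanish : ([set` graph_gens] `<=` vanishing bs (arr_compl L))%classic.
Proof.
move=> _ /mapP[e _ ->] z [zT /sub_graph zL].
by rewrite linearB /= ev_mono chr_chi ev_lform -zL subrr.
Qed.

Lemma arr_compl_torus z : arr_compl L z -> in_torus z. Proof. by case. Qed.

(** Modulo the generators every basis monomial is congruent to a linear form in the
    free monomials [B b]. After clearing denominators, [f] is thus congruent to
    a polynomial [g] in the free monomials alone. If [f] vanishes on the
    arrangement complement, then [g] times the product [h] of all the linear
    forms vanishes at each point [z] of the torus: either [h] is zero at [z], or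
    the free coordinates of [z] extend to a point [z'] of the complement, and
    [g z = g z' = 0]. As the group algebra is a domain and [h] is nonzero, [g = 0]. *)
Lemma vanishing_graph : (arr_compl L !=set0)%classic ->
  vanishing bs (arr_compl L) = ideal_gen [set` graph_gens].
Proof.
move=> [z0 [z0T z0L]]; set J := ideal_gen _.
have iJ : is_ideal J by exact: ideal_gen_ideal.
have Jvan : (J `<=` vanishing bs (arr_compl L))%classic.
  apply: ideal_gen_min graph_gens_vanish.
  exact: vanishing_is_ideal arr_compl_torus.
apply/seteqP; split=> // f fY.
have [v vf] := exists_clears bs f.
pose m u : S := \prod_e lform e ^+ `|crd (u + v) e|.
pose g := \sum_(u <- msupp f) f@_u *: m u.
have Jfg : J (mono K v * f - g).
  have -> : mono K v * f - g =
      \sum_(u <- msupp f) (f@_u *: 1) * (mono K (u + v) - m u).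
    rewrite {1}[f]galg_mono mulr_sumr -sumrB; apply: eq_bigr => u _.
    by rewrite -scalerAl mul1r scalerBr -scalerAr [u + v]addrC monoD.
  rewrite big_seq; apply: (ideal_sum iJ) => u uf; apply: (idealMl iJ).
  rewrite -(char_pow_mono bs); apply: (ideal_cong_prod iJ) => e _.
  have := vf u e uf; case: (crd (u + v) e) => // k _ /=.
  apply: (ideal_congX iJ); apply: mem_ideal_gen.
  by apply/mapP; exists e; rewrite ?mem_enum.
have evm z u : in_torus z ->
    ev bs z (m u) = \prod_e (ev bs z (lform e)) ^+ `|crd (u + v) e|.
  move=> zT; rewrite /m.
  rewrite (big_morph (ev bs z) (fun x y => evM bs x y zT) (ev1 bs z)).
  apply: eq_bigr => e _; elim: `|_|%N => [|k IH]; first exact: ev1.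
  by rewrite !exprS evM // IH.
pose h := \prod_e lform e.
have evh z : in_torus z -> ev bs z h = \prod_e ev bs z (lform e).
  by move=> zT; rewrite (big_morph (ev bs z) (fun x y => evM bs x y zT) (ev1 bs z)).
have gh0 : g * h = 0.
  apply: (ev_torus_eq0 (bs := bs)) => z zT; rewrite evM //.
  pose z' : 'rV[K]_n := \row_e ev bs z (lform e).
  have [z'T|] := pselect (in_torus z'); last first.
    move=> /existsNP [e /negP]; rewrite negbK mxE => /eqP e0.
    by rewrite evh // (bigD1 e) //= e0 mul0r mulr0.
  have z'B b : z' 0 (B b) = z 0 (B b).
    rewrite mxE ev_lform (bigD1 b) //= LB eqxx mul1r big1 ?addr0 // => b' ne.
    by rewrite LB (negbTE ne) mul0r.
  have z'L : arr_compl L z'.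
    split=> //; apply/sub_graph => e; rewrite mxE ev_lform.
    by apply: eq_bigr => b _; rewrite z'B.
  have -> : ev bs z g = ev bs z' g.
    rewrite /g !linear_sum /=; apply: eq_bigr => u _; rewrite !evZ !evm //.
    congr (_ * _); apply: eq_bigr => e _; congr (_ ^+ _); rewrite !ev_lform.
    by apply: eq_bigr => b _; rewrite z'B.
  suff -> : ev bs z' g = 0 by rewrite mul0r.
  have /eqP := Jvan _ Jfg _ z'L; rewrite linearB /= evM // fY // mulr0 sub0r.
  by rewrite oppr_eq0 => /eqP.
have g0 : g = 0.
  apply: (galg_mul_eq0 bs gh0) => h0.
  have /eqP := evh z0 z0T; rewrite h0 linear0 eq_sym => /prodf_eq0[e _].
  move/sub_graph: z0L => z0L; rewrite ev_lform -z0L => /eqP ze.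
  by have := z0T e; rewrite ze eqxx.
have -> : f = mono K (- v) * (mono K v * f - g).
  by rewrite g0 subr0 mulrA monoNK mul1r.
exact: (idealMl iJ).
Qed.

(** The quotient is a localization of the polynomial ring in the free monomials,
    and a morphism from it lifts by lifting the images of the free variables;
    the images of the other monomials are forced to be the linear forms
    in these, and they stay invertible by [unit_lift]. *)
Lemma graph_formally_smooth : formally_smooth_quotient (ideal_gen [set` graph_gens]).
Proof.
move=> C C' pi surj nil phi phi0.
have [beta piB] := choice (fun b => surj (phi (mono K (chi (B b))))).
pose q e := \sum_b L b e *: beta b.
have qB b : q (B b) = beta b.
  rewrite /q (bigD1 b) //= LB eqxx scale1r big1 ?addr0 // => b' ne.
  by rewrite LB (negbTE ne) scale0r.
have piq e : pi (q e) = phi (mono K (chi e)).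
  have : phi (mono K (chi e) - lform e) = 0.
    by apply: phi0; apply: mem_ideal_gen; apply/mapP; exists e; rewrite ?mem_enum.
  move=> /eqP; rewrite linearB subr_eq0 => /eqP ->.
  rewrite /q /lform !linear_sum; apply: eq_bigr => b _.
  by rewrite !linearZ /= piB.
have qV e : exists q', q e * q' = 1 /\ pi q' = phi (mono K (- chi e)).
  have [y yE] := surj (phi (mono K (- chi e))).
  rewrite -yE; apply: (unit_lift nil).
  suff : pi (q e) * pi y = 1 by [].
  by rewrite piq yE -rmorphM -monoD subrr rmorph1.
have [q' q'P] := choice qV.
have qK e : q e * q' e = 1 by case: (q'P e).
have piq' e : pi (q' e) = phi (mono K (- chi e)) by case: (q'P e).
pose psi := galg_ext_lrmorphism (char_pow0 bs q q') (char_powD bs qK).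
have psi_mono u : psi (mono K u) = char_pow bs q q' u by exact: galg_ext_mono.
clearbody psi; exists psi; split.
  have ker_ideal : is_ideal [set f | psi f = 0]%classic.
    split=> [|x y /= x0 y0|a x /= x0]; first exact: linear0.
      by rewrite /mkset rmorphD /= x0 y0 addr0.
    by rewrite /mkset rmorphM /= x0 mulr0.
  move=> f fJ; apply: (ideal_gen_min ker_ideal _ fJ) => _ /mapP[e _ ->] /=.
  rewrite /mkset linearB /= psi_mono char_pow_chi /lform linear_sum /=.
  apply/eqP; rewrite subr_eq0; apply/eqP/eq_bigr => b _.
  by rewrite linearZ /= psi_mono char_pow_chi qB.
move=> f; rewrite [f]galg_mono !linear_sum; apply: eq_bigr => u _.
rewrite !linearZ /= psi_mono (lrmorph_mono bs phi) /char_pow rmorph_prod /=.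
congr (_ *: _); apply: eq_bigr => e _.
by rewrite rmorph_zpow; congr (zpow _ _ _); [exact: piq | exact: piq'].
Qed.

Lemma graph_smooth : smooth_quotient (ideal_gen [set` graph_gens]).
Proof. by split; [exists graph_gens | exact: graph_formally_smooth]. Qed.

End GraphIdeal.

(** * Initial degenerations of linear spaces *)

(** Exchange of basis elements in the matroid of [V]. For a set of columns [f] that
    is a basis of maximal total weight, reduce [V] to the identity on [f]. If the
    entry at [(b, e)] is nonzero, then replacing the column [f b] by [e] gives
    another basis, hence [e] weighs at most as much as [f b]. *)
Lemma max_weight_basis (K : fieldType) (R : realDomainType) r n
    (V : 'M[K]_(r, n)) (omega : 'I_n -> R) : row_free V ->
  exists (B : 'I_r -> 'I_n) (L : 'M[K]_(r, n)),
    [/\ forall b b', L b (B b') = (b == b')%:R, (L :=: V)%MS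
      & forall b e, L b e != 0 -> omega e <= omega (B b)].
Proof.
move=> freeV; pose P (f : {ffun 'I_r -> 'I_n}) := colsub f V \in unitmx.
have fullVT : row_full V^T by rewrite /row_full mxrank_tr.
pose f0 : {ffun 'I_r -> 'I_n} := [ffun b => fullrankfun fullVT b].
have Pf0 : P f0.
  have := fullrowsub_unit fullVT; rewrite -unitmx_tr /P.
  suff -> : (rowsub (fullrankfun fullVT) V^T)^T = colsub f0 V by [].
  by apply/matrixP => i j; rewrite !mxE [f0 j]ffunE.
have [f Pf fmax] := @arg_maxP _ R _ f0 P (fun f => \sum_b omega (f b)) Pf0.
pose L := invmx (colsub f V) *m V.
have LB b b' : L b (f b') = (b == b')%:R.
  have : colsub f L = 1%:M by rewrite /L -mulmx_colsub mulVmx.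
  by move/matrixP/(_ b b'); rewrite !mxE.
have LV : (L :=: V)%MS by apply/eqmxMfull; rewrite row_full_unit unitmx_inv.
have subL g : colsub g L = invmx (colsub f V) *m colsub g V by rewrite mulmx_colsub.
clearbody L; exists f, L; split=> //.
move=> b e Lbe.
pose f' : {ffun 'I_r -> 'I_n} := [ffun b' => if b' == b then e else f b'].
have Pf' : P f'.
  have -> : P f' = (colsub f' L \in unitmx).
    by rewrite subL unitmx_mul unitmx_inv (Pf : colsub f V \in unitmx).
  rewrite -row_free_unit; apply: inj_row_free => y y0.
  have yE b' : b' != b -> y 0 b' = 0.
    move=> ne; move/rowP/(_ b'): y0; rewrite mxE (bigD1 b') //= !mxE [f' b']ffunE (negbTE ne).
    rewrite LB eqxx mulr1 big1 ?addr0 // => i ni.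
    by rewrite [colsub _ _ _ _]mxE [f' b']ffunE (negbTE ne) LB (negbTE ni) mulr0.
  apply/rowP => i; rewrite [RHS]mxE; have [->|] := eqVneq i b; last exact: yE.
  move/rowP/(_ b): y0; rewrite mxE (bigD1 b) //= !mxE [f' b]ffunE eqxx.
  rewrite big1 ?addr0 => [/eqP|k nk]; last by rewrite yE // mul0r.
  by rewrite mulf_eq0 (negbTE Lbe) orbF => /eqP.
(* Both bases have the same weight apart from the columns [e] and [f b]. *)
have := fmax _ Pf'; rewrite /= (bigD1 b) //= [leRHS](bigD1 b) //= [f' b]ffunE eqxx.
rewrite [X in _ + X](eq_bigr (fun i => omega (f i))) ?lerD2r // => i /negbTE ni.
by rewrite [f' i]ffunE ni.
Qed.

Section Limit.
Local Open Scope classical_set_scope.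
Context (M : zmodType) (n : nat) (bs : lattice_basis M n).
Context (K : numFieldType) (R : realDomainType) (pw : R -> nat -> K).
Context (pw0 : forall j, pw 0 j = 1).
Context (pwD : forall a b j, pw (a + b) j = pw a j * pw b j).
Context (pw_cvg : forall a, 0 < a -> pw a j @[j --> \oo] --> (0 : K)).
Local Notation S := (galg M K).
Local Notation crd := (bcoord bs).

Lemma pw_neq0 a j : pw a j != 0.
Proof.
have /eqP := pw0 j; rewrite -(subrr a) pwD; apply: contraTneq => ->.
by rewrite mul0r eq_sym oner_eq0.
Qed.

Lemma pwN a j : pw (- a) j = (pw a j)^-1.
Proof.
by apply: (mulfI (pw_neq0 a j)); rewrite -pwD subrr pw0 mulfV // pw_neq0.
Qed.

Lemma pw_expz a j (m : int) : pw a j ^ m = pw (a *~ m) j.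
Proof.
have X k : pw a j ^+ k = pw (a *+ k) j.
  by elim: k => [|k IH]; rewrite ?mulr0n ?pw0 // exprS mulrS pwD IH.
by case: m => k; rewrite ?NegzE -?exprnN /exprz X // -pwN.
Qed.

Lemma cvg_expz (u : nat -> K) l (m : int) : l != 0 ->
  u j @[j --> \oo] --> l -> u j ^ m @[j --> \oo] --> l ^ m.
Proof.
move=> l0 ul.
have X k : u j ^+ k @[j --> \oo] --> l ^+ k.
  elim: k => [|k IH]; first exact: cvg_cst.
  under eq_fun do rewrite exprS.
  by rewrite exprS; exact: cvgM.
case: m => k; first exact: X.
by apply: cvgV; [rewrite expf_neq0 | exact: X].
Qed.

Lemma cvg_chr (z : nat -> 'rV[K]_n) l u : in_torus l ->
  (forall e, z j 0 e @[j --> \oo] --> l 0 e) ->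
  chr bs (z j) u @[j --> \oo] --> chr bs l u.
Proof.
move=> l0 zl; rewrite /chr; apply: cvg_big => [|e _]; first exact: mul_continuous.
exact: cvg_expz.
Qed.

Context (omega : 'I_n -> R).

(** The pairing with the cocharacter whose coordinates are [omega]. *)
Definition weight (u : M) : R := \sum_e omega e *~ crd u e.

Definition init_form (f : S) : S :=
  \sum_(u <- msupp f | all (fun v => weight u <= weight v) (msupp f)) f@_u *: mono K u.

Context (r : nat) (B : 'I_r -> 'I_n) (L : 'M[K]_(r, n)).
Context (LB : forall b b', L b (B b') = (b == b')%:R).
Context (Lomega : forall b e, L b e != 0 -> omega e <= omega (B b)).

(** Matrix of the initial linear forms: column [e] of [L] expresses coordinate [e],
    of weight [omega e], through coordinates of weights at least [omega e], and
    the terms of larger weight are dropped. *)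
Definition init_mx : 'M[K]_(r, n) :=
  \matrix_(b, e) (if omega e == omega (B b) then L b e else 0).

Lemma init_mxB b b' : init_mx b (B b') = (b == b')%:R.
Proof.
rewrite mxE LB; case: ifP => //; have [->|//] := eqVneq b b'.
by rewrite eqxx.
Qed.

(** Let [t] tend to 0, and let [pw a] be the function [t^a] along the sequence. A
    point [z] of the limit arrangement complement is approached by
    [t^(- omega) x t], where [x t] is the point of the row space of [L] with free
    coordinates [z (B b) t^(omega (B b))]. This uses that [L] has no terms of
    smaller weight. Dividing [f (x t) = 0] by the lowest power of [t] and letting
    [t] tend to 0 leaves the initial form of [f] at [z]. *)
Lemma init_form_vanishing f : vanishing bs (arr_compl L) f ->
  vanishing bs (arr_compl init_mx) (init_form f).
Proof.
move=> f0 z [zT /(sub_graph init_mxB) zL].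
case: (pselect (exists2 u, u \in msupp f &
    all (fun v => weight u <= weight v) (msupp f))); last first.
  move=> H; rewrite /init_form big1_fset ?linear0 // => u uf uall.
  by case: H; exists u.
move=> [u0 u0f /allP u0min].
pose zeta j : 'rV[K]_n :=
  \row_e \sum_b z 0 (B b) * (L b e * pw (omega (B b) - omega e) j).
pose x j : 'rV[K]_n := \row_e (pw (omega e) j * zeta j 0 e).
have xL j : (x j <= L)%MS.
  apply/submxP; exists (\row_b (z 0 (B b) * pw (omega (B b)) j)).
  apply/rowP => e; rewrite !mxE mulr_sumr; apply: eq_bigr => b _; rewrite mxE.
  have -> : pw (omega (B b)) j = pw (omega (B b) - omega e) j * pw (omega e) j.
    by rewrite -pwD subrK.
  ring.
have zetaz e : zeta j 0 e @[j --> \oo] --> z 0 e.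
  rewrite zL; under eq_fun do rewrite mxE.
  apply: cvg_big => [|b _]; first exact: add_continuous.
  rewrite [X in _ --> X]mulrC; apply: cvgM; first exact: cvg_cst.
  rewrite mxE; case: eqVneq => [->|ne].
    under eq_fun do rewrite subrr pw0 mulr1.
    exact: cvg_cst.
  have [->|L0] := eqVneq (L b e) 0.
    under eq_fun do rewrite mul0r.
    exact: cvg_cst.
  rewrite -(mulr0 (L b e)); apply: cvgM; first exact: cvg_cst.
  by apply: pw_cvg; rewrite subr_gt0 lt_neqAle ne Lomega.
have nearT : \forall j \near \oo, in_torus (zeta j).
  have : \forall j \near \oo, forall e, zeta j 0 e != 0.
    apply: filter_forall => e; exact: cvgr_neq0 (zetaz e) (zT e).
  by apply: filterS.
pose T j := \sum_(u <- msupp f)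
  f@_u * (pw (weight u - weight u0) j * chr bs (zeta j) u).
have T0 : \forall j \near \oo, T j = 0.
  apply: filterS nearT => j zjT.
  have xT : in_torus (x j) by move=> e; rewrite mxE mulf_neq0 // pw_neq0.
  have chrx u : chr bs (x j) u = pw (weight u) j * chr bs (zeta j) u.
    rewrite /weight (big_morph (fun a => pw a j) (fun a b => pwD a b j) (pw0 j)).
    rewrite /chr -big_split /=; apply: eq_bigr => e _.
    by rewrite mxE expfzMl pw_expz.
  have /(congr1 (fun c => pw (- weight u0) j * c)) := f0 _ (conj xT (xL j)).
  rewrite mulr0 => <-; rewrite /ev mulr_sumr; apply: eq_bigr => u _.
  by rewrite chrx [weight u - _]addrC pwD; ring.
have Tlim : T j @[j --> \oo] --> \sum_(u <- msupp f)
    (if weight u == weight u0 then f@_u * chr bs z u else 0).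
  rewrite /T big_seq; under eq_fun do rewrite big_seq.
  apply: cvg_big => [|u uf]; first exact: add_continuous.
  have cz : chr bs (zeta j) u @[j --> \oo] --> chr bs z u by exact: cvg_chr zT zetaz.
  case: eqVneq => [->|ne].
    under eq_fun do rewrite subrr pw0 mul1r.
    by apply: cvgM => //; exact: cvg_cst.
  rewrite -(mulr0 f@_u) -(mul0r (chr bs z u)).
  apply: cvgM; first exact: cvg_cst.
  apply: cvgM => //; apply: pw_cvg.
  by rewrite subr_gt0 lt_neqAle eq_sym ne u0min.
have <- : \sum_(u <- msupp f) (if weight u == weight u0 then f@_u * chr bs z u else 0)
    = ev bs z (init_form f).
  rewrite /init_form linear_sum /= [RHS]big_mkcond big_seq [RHS]big_seq.
  apply: eq_bigr => u uf; rewrite evZ ev_mono.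
  suff -> : (weight u == weight u0) = all (fun v => weight u <= weight v) (msupp f) by [].
  apply/eqP/allP => [-> //|umin]; apply: le_anti.
  by rewrite umin //= u0min.
apply: cvg_unique Tlim _; first exact: norm_hausdorff.
exact: cvg_near_cst.
Qed.

End Limit.

Section InitialCircuits.
Context (M : zmodType) (n : nat) (bs : lattice_basis M n).
Context (K : numFieldType) (R : realDomainType) (omega : 'I_n -> R).
Context (r : nat) (B : 'I_r -> 'I_n) (L : 'M[K]_(r, n)).
Context (LB : forall b b', L b (B b') = (b == b')%:R).
Context (Lomega : forall b e, L b e != 0 -> omega e <= omega (B b)).
Local Notation S := (galg M K).
Local Notation chi := (bvec bs).
Local Notation wt := (weight bs omega).
Local Notation Lw := (init_mx omega B L).

Lemma weight_chi e : wt (chi e) = omega e.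
Proof.
rewrite /weight (bigD1 e) //= bcoord_bvec eqxx big1 ?addr0 // => i ne.
by rewrite bcoord_bvec eq_sym (negbTE ne).
Qed.

Lemma bvec_inj : injective chi.
Proof.
move=> i j ij; have := bcoord_bvec bs j i; rewrite -ij bcoord_bvec eqxx.
by case: eqP.
Qed.

Lemma mcoeff_init_form (f : S) v : (init_form bs omega f)@_v =
  if all (fun v' => wt v <= wt v') (msupp f) then f@_v else 0.
Proof.
rewrite /init_form raddf_sum /= big_mkcond /=.
under eq_bigr => u _ do rewrite mcoeffZ mcoeff_mono.
have [vf|vf] := boolP (v \in msupp f).
  rewrite (big_fsetD1 v) //= eqxx mulr1 big1_fset ?addr0 // => u.
  by rewrite in_fsetD1 => /andP[/negbTE ->] _ _; rewrite mulr0 if_same.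
rewrite mcoeff_outdom // if_same big1_fset // => u uf _.
by case: eqP uf vf => [<- -> |_ _ _] //; rewrite mulr0 if_same.
Qed.

Lemma mcoeff_graph_gen (L' : 'M[K]_(r, n)) e v :
  (mono K (chi e) - lform bs B L' e)@_v =
  (chi e == v)%:R - \sum_b L' b e * (chi (B b) == v)%:R.
Proof.
rewrite mcoeffB mcoeff_mono /lform raddf_sum /=; congr (_ - _).
by apply: eq_bigr => b _; rewrite mcoeffZ mcoeff_mono.
Qed.

(** All the monomials of the linear relation for [e] weigh at least [omega e], which
    is attained at [e] itself. *)
Lemma init_form_graph_gen e : (forall b, e != B b) ->
  init_form bs omega (mono K (chi e) - lform bs B L e) =
  mono K (chi e) - lform bs B Lw e.
Proof.
move=> eB; apply/malgP => v; rewrite mcoeff_init_form !mcoeff_graph_gen.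
have supp_e : chi e \in msupp (mono K (chi e) - lform bs B L e).
  rewrite -mcoeff_neq0 mcoeff_graph_gen eqxx big1 ?subr0 ?oner_eq0 // => b _.
  by rewrite (inj_eq bvec_inj) eq_sym (negbTE (eB b)) mulr0.
have supp_ge u : u \in msupp (mono K (chi e) - lform bs B L e) -> omega e <= wt u.
  rewrite -mcoeff_neq0 mcoeff_graph_gen; apply: contraNT; rewrite -ltNge => lt_u.
  have -> : (chi e == u) = false.
    by apply: contraTF lt_u => /eqP <-; rewrite weight_chi ltxx.
  rewrite big1 ?subr0 // => b _; case: eqP => [E|_]; last exact: mulr0.
  rewrite mulr1; apply/eqP; apply: contraTT lt_u => /Lomega.
  by rewrite -E weight_chi -leNgt.
have -> : all (fun v' => wt v <= wt v') (msupp (mono K (chi e) - lform bs B L e))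
    = (wt v <= omega e).
  apply/allP/idP => [/(_ _ supp_e)|le_v u uf]; first by rewrite weight_chi.
  exact: le_trans le_v (supp_ge u uf).
case: ifPn => [le_v|]; last rewrite -ltNge => lt_v.
  congr (_ - _); apply: eq_bigr => b _; case: eqP => [E|_]; last by rewrite !mulr0.
  rewrite mxE; case: ifP => // /negbT ne; congr (_ * _).
  apply/eqP; apply: contraNT ne => /Lomega le_b; rewrite eq_le le_b /=.
  by rewrite -(weight_chi (B b)) E.
have -> : (chi e == v) = false.
  by apply: contraTF lt_v => /eqP <-; rewrite weight_chi ltxx.
rewrite big1 ?subr0 // => b _; case: eqP => [E|_]; last exact: mulr0.
rewrite mxE -E weight_chi in lt_v *.
by rewrite lt_eqF // mul0r.
Qed.

(** A point of the moment curve [(1, s, s^2, ...)] avoids finitely many given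
    hyperplanes for general [s]. *)
Lemma arr_compl_nonempty (L' : 'M[K]_(r, n)) :
  (forall e, exists b, L' b e != 0) -> (arr_compl L' !=set0)%classic.
Proof.
move=> col.
pose p e : {poly K} := \poly_(i < r) (if insub i is Some b then L' b e else 0).
have pE e (b : 'I_r) : (p e)`_b = L' b e.
  by rewrite coef_poly ltn_ord valK.
have p0 e : p e != 0.
  have [b] := col e; apply: contraNneq => p0; by rewrite -pE p0 coef0.
have P0 : \prod_e p e != 0 by apply/prodf_neq0.
have [s] := exists_nonroot P0.
rewrite horner_prod => /prodf_neq0 ps.
exists (\row_b s ^+ b *m L'); split; last exact: submxMl.
move=> e; rewrite mxE; apply: contraNneq (ps e isT) => <-; apply/eqP.
rewrite horner_poly; apply: eq_bigr => b _; rewrite valK mxE mulrC //.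
Qed.

End InitialCircuits.

Section Complex.
Context (R : realType).
Local Open Scope classical_set_scope.
Local Open Scope complex_scope.

(** The functions [t^a] along the sequence [t = exp (- j)]. *)
Definition cpow (a : R) (j : nat) : R[i] := (expR (- a) ^+ j)%:C.

Lemma cpow0 j : cpow 0 j = 1.
Proof. by rewrite /cpow oppr0 expR0 expr1n. Qed.

Lemma cpowD a b j : cpow (a + b) j = cpow a j * cpow b j.
Proof. by rewrite /cpow opprD expRD exprMn rmorphM. Qed.

Lemma cpow_cvg a : 0 < a ->
  (cpow a : nat -> (R[i] : numFieldType)) j @[j --> \oo] --> (0 : (R[i] : numFieldType)).
Proof.
move=> a0; apply/cvgrPdist_lt => eps eps0.
have [e e0 ee] : exists2 e : R, 0 < e & e%:C = eps.
  by case: eps eps0 => x y; rewrite ltcE /= => /andP[/eqP -> x0]; exists x.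
have lt1 : `|expR (- a)| < 1 by rewrite ger0_norm ?expR_ge0 // expR_lt1 oppr_lt0.
have /cvgrPdist_lt/(_ e e0) := cvg_expr lt1.
apply: filterS => j; rewrite !sub0r !normrN -ee /cpow.
by rewrite normc_def /= expr0n /= addr0 sqrtr_sqr ltcR.
Qed.

Context (k n : nat) (bs : lattice_basis (character k) n).

Lemma exponentD (u v : character k) A : (u + v) A = u A + v A.
Proof. by rewrite [LHS]ffunE. Qed.

Lemma pairingD u v (w : pidx k -> R) :
  pairing (u + v) w = pairing u w + pairing v w.
Proof.
rewrite /pairing -big_split /=; apply: eq_bigr => A _.
by rewrite -mulrDl -intrD exponentD.
Qed.

Lemma pairing_weight u (w : pidx k -> R) :
  pairing u w = weight bs (fun e => pairing (bvec bs e) w) u.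
Proof.
have pD u1 u2 : pairing (u1 + u2) w = pairing u1 w + pairing u2 w.
  exact: pairingD.
have p0 : pairing 0 w = 0 by apply: (addrI (pairing 0 w)); rewrite -pD !addr0.
rewrite {1}(bcoordK bs u) (big_morph (fun v => pairing v w) pD p0).
by apply: eq_bigr => e _; rewrite (additive_mulrz pD).
Qed.

Lemma initial_formE (w : pidx k -> R) f :
  initial_form w f = init_form bs (fun e => pairing (bvec bs e) w) f.
Proof.
rewrite /initial_form /init_form; apply: eq_big => [u|u _].
  by apply: eq_all => v; rewrite !pairing_weight.
by rewrite scale_mono.
Qed.

(** With respect to a basis of maximal weight, the relations that express the other
    coordinates have initial forms of the same shape, given by [init_mx]. These
    initial forms lie in the initial ideal, and they generate the vanishing ideal
    of the arrangement complement of [init_mx], which contains the initial ideal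
    by the limit argument. That complement is nonempty because a zero column of
    [init_mx] would put a monomial into the initial ideal. *)
Theorem linear_initial_degenerations r (V : 'M[R[i]]_(r, n)) (w : pidx k -> R) :
  row_free V -> Trop (vanishing bs (arr_compl V)) w ->
  smooth_quotient (initial_ideal w (vanishing bs (arr_compl V))) /\
  irreducible_quotient (initial_ideal w (vanishing bs (arr_compl V))).
Proof.
set I := vanishing _ _ => freeV wTrop; set omega := fun e => pairing (bvec bs e) w.
have [B [L [LB LV Lomega]]] := max_weight_basis omega freeV.
have VL : arr_compl V = arr_compl L.
  by apply/seteqP; split=> z [zT zV]; split=> //; rewrite ?LV // -LV.
pose Lw := init_mx omega B L; have LwB := init_mxB omega LB : forall b b', Lw b (B b') = _.
have gens_sub : (ideal_gen [set` graph_gens bs B Lw] `<=` initial_ideal w I).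
  apply: ideal_gen_min; first exact: ideal_gen_ideal.
  move=> _ /mapP[e _ ->].
  have [[b ->]|eB] := pselect (exists b, e = B b).
    rewrite /lform (bigD1 b) //= LwB eqxx scale1r big1 ?addr0 ?subrr.
      exact: ideal0 (ideal_gen_ideal _).
    by move=> b' ne; rewrite LwB (negbTE ne) scale0r.
  apply: mem_ideal_gen; exists (mono _ (bvec bs e) - lform bs B L e).
    rewrite /I VL => z Lz; apply: (graph_gens_vanish LB) Lz.
    by apply/mapP; exists e; rewrite ?mem_enum.
  rewrite initial_formE init_form_graph_gen // => b.
  by apply/eqP => E; apply: eB; exists b.
have ne : arr_compl Lw !=set0.
  apply: arr_compl_nonempty => e; apply: contrapT => Le.
  have iI : is_ideal (initial_ideal w I) by exact: ideal_gen_ideal.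
  have L0 b : Lw b e = 0 by apply/eqP; apply: contrapT => /negP Lbe; apply: Le; exists b.
  have I1 : initial_ideal w I 1.
    rewrite -(monoNK _ (bvec bs e)); apply: (idealMl iI); apply: gens_sub.
    rewrite -[mono _ _]subr0 -[X in _ - X](_ : lform bs B Lw e = 0).
      by apply: mem_ideal_gen; apply/mapP; exists e; rewrite ?mem_enum.
    by rewrite /lform big1 // => b _; rewrite L0 scale0r.
  apply: wTrop; apply/seteqP; split=> f _; last first.
    by rewrite -[f]mulr1; exact: (idealMl iI).
  have i1 : is_ideal (ideal_gen [set (1 : laurent k R[i])]) by exact: ideal_gen_ideal.
  by rewrite -[f]mulr1; apply: (idealMl i1); exact: mem_ideal_gen.
have -> : initial_ideal w I = ideal_gen [set` graph_gens bs B Lw].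
  apply/seteqP; split=> //; rewrite -vanishing_graph //.
  apply: ideal_gen_min.
    by apply: vanishing_is_ideal => z; exact: arr_compl_torus.
  move=> _ [f fI <-]; rewrite initial_formE.
  apply: (init_form_vanishing cpow0 cpowD cpow_cvg LB Lomega).
  by rewrite -VL.
split; first exact: graph_smooth.
by apply: prime_irreducible; rewrite -vanishing_graph //; exact: arr_compl_prime.
Qed.

End Complex.

(** * A basis of the character lattice for four-dimensional flags *)

(** Indicator sequences of the proper nonempty subsets of a four-element set, in the
    order 1, 2, 3, 4, 12, 13, 23, 14, 24, 34, 123, 124, 134, 234. *)
Definition flag4_bits : seq bitseq :=
  [:: [:: true; false; false; false]; [:: false; true; false; false];
      [:: false; false; true; false]; [:: false; false; false; true];
      [:: true; true; false; false]; [:: true; false; true; false];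
      [:: false; true; true; false]; [:: true; false; false; true];
      [:: false; true; false; true]; [:: false; false; true; true];
      [:: true; true; true; false]; [:: true; true; false; true];
      [:: true; false; true; true]; [:: false; true; true; true]].

Lemma enum_I4 : enum 'I_4 = [:: inord 0; inord 1; inord 2; inord 3].
Proof.
by apply: (inj_map val_inj); rewrite val_enum_ord /= !inordK.
Qed.

Definition bits_set (s : bitseq) : {set 'I_4} := [set i | nth false s (val i)].

Lemma enum_bits_set s :
  enum (bits_set s) = [seq i <- enum 'I_4 | nth false s (val i)].
Proof.
by rewrite /enum_mem -filter_predI; apply: eq_filter => i /=; rewrite !inE andbT.
Qed.

Lemma bits_set_proof s : s \in flag4_bits -> (0 < #|bits_set s| < 4)%N.
Proof.
rewrite cardE enum_bits_set enum_I4.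
have : all (fun s => 0 < size [seq i <- [:: inord 0; inord 1; inord 2; inord 3]
    | nth false s (\val (i : 'I_4))] < 4)%N flag4_bits.
  by rewrite /= !inordK.
by move=> /allP; apply.
Qed.

Definition pidx4 (s : bitseq) : pidx 4 :=
  insubd (exist _ (bits_set (head [::] flag4_bits)) (bits_set_proof (mem_head _ _)))
    (bits_set s).

Lemma val_pidx4 s : s \in flag4_bits -> val (pidx4 s) = bits_set s.
Proof. by move=> sP; rewrite /pidx4 val_insubd bits_set_proof. Qed.

Definition bits (A : pidx 4) : bitseq := [seq i \in val A | i <- enum 'I_4].

Lemma bits_in A : bits A \in flag4_bits.
Proof.
have := valP A; rewrite cardE {1 2}/enum_mem -enumT /bits enum_I4 /=.
by do 4 case: (_ \in _).
Qed.

Lemma bitsK : cancel bits pidx4.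
Proof.
move=> A; have : val (pidx4 (bits A)) = val A.
  rewrite val_pidx4 ?bits_in //.
  apply/setP => i; rewrite inE /bits (nth_map i) ?size_enum_ord ?ltn_ord //.
  by rewrite nth_ord_enum.
exact: val_inj.
Qed.

Lemma pidx4K s : s \in flag4_bits -> bits (pidx4 s) = s.
Proof.
move=> sP; rewrite /bits val_pidx4 // enum_I4 /= !inE /= !inordK //.
by apply/eqP; move: s sP; apply/allP.
Qed.

Lemma big_pidx4 (T : Type) (idx : T) (op : Monoid.com_law idx) (P : pred (pidx 4)) F :
  \big[op/idx]_(A | P A) F A = \big[op/idx]_(s <- flag4_bits | P (pidx4 s)) F (pidx4 s).
Proof.
rewrite -(big_map pidx4 P F); apply: perm_big; apply: uniq_perm.
- exact: index_enum_uniq.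
- rewrite map_inj_in_uniq // => s t sP tP /(congr1 bits).
  by rewrite !pidx4K.
- move=> A; rewrite mem_index_enum; apply/esym/mapP; exists (bits A); rewrite ?bits_in //.
  by rewrite bitsK.
Qed.

Lemma card_pidx4 s : s \in flag4_bits -> #|val (pidx4 s)| = count id s.
Proof.
move=> sP; rewrite val_pidx4 // cardE enum_bits_set enum_I4 /= !inordK //.
by apply/eqP; move: s sP; apply/allP.
Qed.

Lemma sum_foldr (T : Type) (r : seq T) (F : T -> int) :
  \sum_(s <- r) F s = foldr (fun s a => F s + a) 0 r.
Proof. by elim: r => [|s r IH]; rewrite ?big_nil // big_cons IH. Qed.

Definition tab (T : seq (seq int)) (e : nat) (s : bitseq) : int :=
  nth 0 (nth [::] T e) (index s flag4_bits).

(** Exponents, in the order of [flag4_bits], of the eleven coordinates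
<<
  s_i = p_i p_34 / (p_4 p_i4)                    for i = 1, 2, 3,
  x_i = p_jk p_i4 / (p_14 p_24)                  for i = 1, 2, 3,
  t_i = p_jk4 p_ij p_ik / (p_123 p_14 p_24)      for i = 1, 2, 3,
  a_1 = p_14 / p_34,   a_2 = p_24 / p_34,
>>
    where {i, j, k} = {1, 2, 3}. The line [F_2] meets the coordinate hyperplanes
    in four points, which are put at [s_1, s_2, s_3] and infinity, with [F_1] at 0;
    dually [F_3] gives another point, and [t_i] is the coordinate of point [i]
    relative to it. The [x_i] are the differences of the [s_i]. *)
Definition bvec_tab : seq (seq int) :=
 [:: [:: 1; 0; 0; -1; 0; 0; 0; -1; 0; 1; 0; 0; 0; 0];
     [:: 0; 1; 0; -1; 0; 0; 0; 0; -1; 1; 0; 0; 0; 0];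
     [:: 0; 0; 1; -1; 0; 0; 0; 0; 0; 0; 0; 0; 0; 0];
     [:: 0; 0; 0; 0; 0; 0; 1; 0; -1; 0; 0; 0; 0; 0];
     [:: 0; 0; 0; 0; 0; 1; 0; -1; 0; 0; 0; 0; 0; 0];
     [:: 0; 0; 0; 0; 1; 0; 0; -1; -1; 1; 0; 0; 0; 0];
     [:: 0; 0; 0; 0; 1; 1; 0; -1; -1; 0; -1; 0; 0; 1];
     [:: 0; 0; 0; 0; 1; 0; 1; -1; -1; 0; -1; 0; 1; 0];
     [:: 0; 0; 0; 0; 0; 1; 1; -1; -1; 0; -1; 1; 0; 0];
     [:: 0; 0; 0; 0; 0; 0; 0; 1; 0; -1; 0; 0; 0; 0];
     [:: 0; 0; 0; 0; 0; 0; 0; 0; 1; -1; 0; 0; 0; 0]].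

(** Rows of the dual basis. A point of the torus has a representative with
    [p_4 = p_34 = p_123 = 1], so the entries at these places can be taken to be
    zero; solving the definitions of the coordinates for the remaining Plücker
    coordinates gives, for instance, [p_12 = x_3 a_1 a_2] and [p_234 = t_1 / (x_2 x_3 a_1)]. *)
Definition bcoord_tab : seq (seq int) :=
 [:: [:: 1; 0; 0; 0; 0; 0; 0; 0; 0; 0; 0; 0; 0; 0];
     [:: 0; 1; 0; 0; 0; 0; 0; 0; 0; 0; 0; 0; 0; 0];
     [:: 0; 0; 1; 0; 0; 0; 0; 0; 0; 0; 0; 0; 0; 0];
     [:: 0; 0; 0; 0; 0; 0; 1; 0; 0; 0; 0; -1; -1; 0];
     [:: 0; 0; 0; 0; 0; 1; 0; 0; 0; 0; 0; -1; 0; -1];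
     [:: 0; 0; 0; 0; 1; 0; 0; 0; 0; 0; 0; 0; -1; -1];
     [:: 0; 0; 0; 0; 0; 0; 0; 0; 0; 0; 0; 0; 0; 1];
     [:: 0; 0; 0; 0; 0; 0; 0; 0; 0; 0; 0; 0; 1; 0];
     [:: 0; 0; 0; 0; 0; 0; 0; 0; 0; 0; 0; 1; 0; 0];
     [:: 1; 0; 0; 0; 1; 1; 0; 1; 0; 0; 0; 0; 0; -1];
     [:: 0; 1; 0; 0; 1; 0; 1; 0; 1; 0; 0; 0; -1; 0]].

Definition flag4_exponent (e : nat) : {ffun pidx 4 -> int} :=
  [ffun A => tab bvec_tab e (bits A)].

Lemma deg0_pidx4 (u : {ffun pidx 4 -> int}) : u \in @deg0 4 =
  [forall j : 'I_4, \sum_(s <- flag4_bits | count id s == j) u (pidx4 s) == 0].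
Proof.
apply: eq_forallb => j; rewrite big_pidx4 big_seq_cond [X in _ = (X == _)]big_seq_cond.
congr (_ == _); apply: eq_bigl => s; case sP: (s \in flag4_bits) => //=.
by rewrite card_pidx4.
Qed.

Lemma flag4_exponent_deg0 (e : 'I_11) : flag4_exponent e \in @deg0 4.
Proof.
rewrite deg0_pidx4; apply/forallP => j.
rewrite big_seq_cond (eq_bigr (tab bvec_tab e)) => [|s /andP[sP _]]; last first.
  by rewrite ffunE pidx4K.
rewrite -big_seq_cond.
rewrite big_mkcond sum_foldr.
have /allP/(_ (val j)) : all (fun j => all (fun e => foldr (fun s a =>
    (if count id s == j then tab bvec_tab e s else 0) + a) 0 flag4_bits == 0)
  (iota 0 11)) (iota 0 4).
  by vm_compute.
rewrite mem_iota ltn_ord => /(_ isT)/allP/(_ (val e)).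
by rewrite mem_iota ltn_ord => /(_ isT).
Qed.

Definition flag4_bvec (e : 'I_11) : character 4 := Character (flag4_exponent_deg0 e).

Definition flag4_bcoord (u : character 4) (e : 'I_11) : int :=
  \sum_(s <- flag4_bits) tab bcoord_tab e s * u (pidx4 s).

Lemma flag4_bcoordD u v e : flag4_bcoord (u + v) e = flag4_bcoord u e + flag4_bcoord v e.
Proof.
rewrite /flag4_bcoord -big_split /=; apply: eq_bigr => s _.
by rewrite exponentD mulrDr.
Qed.

Lemma flag4_bcoord_bvec i e : flag4_bcoord (flag4_bvec i) e = (i == e)%:R.
Proof.
rewrite /flag4_bcoord big_seq.
rewrite (eq_bigr (fun s => tab bcoord_tab e s * tab bvec_tab i s)) => [|s sP]; last first.
  by rewrite ffunE pidx4K.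
rewrite -big_seq sum_foldr -(inj_eq val_inj) /=.
have /allP/(_ (val i)) : all (fun i => all (fun e => foldr (fun s a =>
    tab bcoord_tab e s * tab bvec_tab i s + a) 0 flag4_bits == (i == e)%:R)
  (iota 0 11)) (iota 0 11).
  by vm_compute.
rewrite mem_iota ltn_ord => /(_ isT)/allP/(_ (val e)).
by rewrite mem_iota ltn_ord => /(_ isT)/eqP.
Qed.

(** The subsets 4, 34, 123, one in each block, at which exponents are determined by
    the vanishing of the block sums. *)
Definition pivots : seq bitseq :=
  [:: [:: false; false; false; true]; [:: false; false; true; true];
      [:: true; true; true; false]].

(** The two tables are inverse to each other up to block sums of exponents, which
    vanish on characters. *)
Lemma tab_inv s s' : s \in flag4_bits -> s' \in flag4_bits ->
  \sum_(e < 11) tab bvec_tab e s * tab bcoord_tab e s' =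
  (s == s')%:R - ((s \in pivots) && (count id s' == count id s))%:R.
Proof.
move=> sP s'P; rewrite -(big_mkord xpredT (fun e => tab bvec_tab e s * tab bcoord_tab e s')).
rewrite /index_iota subn0 sum_foldr; apply/eqP.
move: s' s'P; apply/allP; move: s sP; apply/allP.
by vm_compute.
Qed.

Lemma flag4_bcoordK u : u = \sum_e flag4_bvec e *~ flag4_bcoord u e.
Proof.
apply: val_inj; apply/ffunP => A; have sP := bits_in A.
rewrite -[A]bitsK; set s := bits A in sP *.
pose at_s (v : character 4) : int := v (pidx4 s).
have at_sD v v' : at_s (v + v') = at_s v + at_s v' by exact: exponentD.
have at_s0 : at_s 0 = 0 by rewrite /at_s [LHS]ffunE.
suff : at_s u = at_s (\sum_e flag4_bvec e *~ flag4_bcoord u e) by [].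
rewrite (big_morph at_s at_sD at_s0).
under eq_bigr => e _ do rewrite (additive_mulrz at_sD) /at_s ffunE pidx4K // mulrzz.
under eq_bigr => e _ do rewrite /flag4_bcoord mulr_sumr.
rewrite exchange_big /= big_seq.
under eq_bigr => s' s'P do
  (under eq_bigr => e _ do rewrite mulrA; rewrite -mulr_suml tab_inv // mulrBl).
rewrite -big_seq sumrB.
have -> : \sum_(s' <- flag4_bits) (s == s')%:R * u (pidx4 s') = at_s u.
  rewrite (bigD1_seq s) //= eqxx mul1r big1 ?addr0 // => s' ne.
  by rewrite eq_sym (negbTE ne) mul0r.
have lt4 : (count id s < 4)%N.
  by apply: (allP (isT : all (fun t => count id t < 4)%N flag4_bits)).
have := valP u; rewrite deg0_pidx4 => /forallP/(_ (Ordinal lt4))/eqP /=.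
rewrite big_mkcond /= => du.
have [sp|sp] := boolP (s \in pivots); last first.
  by rewrite big1 ?subr0 // => s' _; rewrite mul0r.
rewrite /= -[LHS]subr0; congr (_ - _); rewrite -[LHS]du; apply: eq_bigr => s' _.
by case: (count id s' == _); rewrite ?mul1r ?mul0r.
Qed.

Definition flag4_basis : lattice_basis (character 4) 11 :=
  LatticeBasis flag4_bcoordD flag4_bcoord_bvec flag4_bcoordK.

(** * Minors of flags in four-space *)

Section TorusPoint.
Context (R : realType) (k n : nat) (bs : lattice_basis (character k) n).

Definition torus_point (p : pidx k -> R[i]) : 'rV[R[i]]_n :=
  \row_e \prod_A p A ^ bvec bs e A.

Lemma torus_point_in p : (forall A, p A != 0) -> in_torus (torus_point p).
Proof. by move=> p0 e; rewrite mxE; apply/prodf_neq0 => A _; rewrite expfz_neq0. Qed.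

Lemma eval_ev p f : (forall A, p A != 0) -> Defs.eval p f = ev bs (torus_point p) f.
Proof.
move=> p0; apply: eq_bigr => u _; congr (_ * _); rewrite /chr.
under [RHS]eq_bigr => e _ do rewrite mxE.
pose mon (u : character k) := \prod_A p A ^ u A.
have monD u1 u2 : mon (u1 + u2) = mon u1 * mon u2.
  rewrite /mon -big_split /=; apply: eq_bigr => A _.
  by rewrite exponentD expfzDr.
have mon0 : mon 0 = 1.
  rewrite /mon big1 // => A _.
  by rewrite (_ : (0 : character k) A = 0) // [LHS]ffunE.
have -> : \prod_A p A ^ u A = mon u by [].
rewrite {1}(bcoordK bs u) (big_morph mon monD mon0).
apply: eq_bigr => e _; rewrite /mon.
rewrite [RHS](big_morph (fun x => x ^ bcoord bs u e)
  (fun x y => expfzMl x y _) (exp1rz _ _)).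
apply: eq_bigr => A _.
by rewrite (additive_mulrz (fun v v' => exponentD v v' A)) mulrzz exprz_exp.
Qed.

End TorusPoint.

Section SmallMinors.
Context (K : comNzRingType) (f : nat -> nat -> K).

Lemma det_fun1 : \det (\matrix_(i < 1, j < 1) f i j) = f 0 0.
Proof. by rewrite det_mx11 mxE. Qed.

Lemma det_fun2 : \det (\matrix_(i < 2, j < 2) f i j) = f 0 0 * f 1 1 - f 0 1 * f 1 0.
Proof.
rewrite (expand_det_row _ ord0) !big_ord_recl big_ord0 /cofactor !det_mx11 !mxE /=.
by rewrite /bump /=; ring.
Qed.

End SmallMinors.

Lemma det_fun3 (K : comNzRingType) (f : nat -> nat -> K) :
  \det (\matrix_(i < 3, j < 3) f i j) =
  f 0 0 * (f 1 1 * f 2 2 - f 1 2 * f 2 1) - f 0 1 * (f 1 0 * f 2 2 - f 1 2 * f 2 0)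
  + f 0 2 * (f 1 0 * f 2 1 - f 1 1 * f 2 0).
Proof.
rewrite (expand_det_row _ ord0) !big_ord_recl big_ord0 /cofactor.
have E j : \det (row' ord0 (col' j (\matrix_(i < 3, j < 3) f i j))) =
    f 1 (bump j 0) * f 2 (bump j 1) - f 1 (bump j 1) * f 2 (bump j 0).
  rewrite -(det_fun2 (fun i k => f i.+1 (bump j k))).
  by congr (\det _); apply/matrixP => i k; rewrite !mxE.
by rewrite !E !mxE /= /bump /=; ring.
Qed.

Definition entry (T : Type) k (M : 'M[T]_(k.+1, 4)) (i j : nat) : T :=
  M (inord i) (inord j).

(** Replaces the enumeration of the set [A], on whose cardinality the type of the
    minor depends, by an explicit list of columns. *)
Lemma plucker_entries (R : realType) (B : forall j : nat, 'M[R[i]]_(j, 4))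
    (A : pidx 4) k (c : seq nat) :
  enum (val A) = [seq inord i | i <- c] -> size c = k.+1 ->
  plucker B A = \det (\matrix_(i < k.+1, j < k.+1) entry (B k.+1) i (nth 0 c j)).
Proof.
move=> Ac ck; have cA : #|val A| = k.+1 by rewrite cardE Ac size_map.
rewrite /plucker; move: (enum_val_nth (A := val A)) => /=.
have : forall i : 'I_#|val A|, enum_val i = inord (nth 0 c i) :> 'I_4.
  move=> i; rewrite (enum_val_nth (inord 0)) Ac (nth_map 0) // ck -cA //.
move: (@enum_val _ _); rewrite cA => g gE _.
by congr (\det _); apply/matrixP => i j; rewrite !mxE gE /entry inord_val.
Qed.

Section FlagMinors.
Context (R : realType) (B : forall j : nat, 'M[R[i]]_(j, 4)).
Local Notation P := (fun s => plucker B (pidx4 s)).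
Local Notation b1 := (entry (B 1) 0).
Local Notation b2 := (entry (B 2)).
Local Notation b3 := (entry (B 3)).

Definition minor2 (i j : nat) : R[i] := b2 0 i * b2 1 j - b2 0 j * b2 1 i.
Definition minor3 (i j k : nat) : R[i] :=
  b3 0 i * (b3 1 j * b3 2 k - b3 1 k * b3 2 j)
  - b3 0 j * (b3 1 i * b3 2 k - b3 1 k * b3 2 i)
  + b3 0 k * (b3 1 i * b3 2 j - b3 1 j * b3 2 i).

Lemma enum_pidx4 s : s \in flag4_bits ->
  enum (val (pidx4 s)) = [seq inord i | i <- iota 0 4 & nth false s i].
Proof.
move=> sP; rewrite val_pidx4 // enum_bits_set enum_I4.
rewrite -[[:: inord 0; _; _; _]]/[seq inord i | i <- iota 0 4] filter_map.
congr map; apply: eq_in_filter => i; rewrite mem_iota => /andP[_ i4] /=.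
by rewrite inordK.
Qed.

Lemma flag4_plucker :
  [seq P s | s <- flag4_bits] =
  [:: b1 0; b1 1; b1 2; b1 3;
     minor2 0 1; minor2 0 2; minor2 1 2; minor2 0 3; minor2 1 3; minor2 2 3;
     minor3 0 1 2; minor3 0 1 3; minor3 0 2 3; minor3 1 2 3].
Proof.
have P1 s i : s \in flag4_bits -> [seq i <- iota 0 4 | nth false s i] = [:: i] ->
    P s = b1 i.
  move=> sP si; rewrite (@plucker_entries _ B _ 0 [:: i]) ?enum_pidx4 ?si //.
  by rewrite (det_fun1 (fun a b => entry (B 1) a (nth 0 [:: i] b))).
have P2 s i j : s \in flag4_bits -> [seq i <- iota 0 4 | nth false s i] = [:: i; j] ->
    P s = minor2 i j.
  move=> sP si; rewrite (@plucker_entries _ B _ 1 [:: i; j]) ?enum_pidx4 ?si //.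
  by rewrite (det_fun2 (fun a b => entry (B 2) a (nth 0 [:: i; j] b))).
have P3 s i j k : s \in flag4_bits ->
    [seq i <- iota 0 4 | nth false s i] = [:: i; j; k] ->
    P s = minor3 i j k.
  move=> sP si; rewrite (@plucker_entries _ B _ 2 [:: i; j; k]) ?enum_pidx4 ?si //.
  by rewrite (det_fun3 (fun a b => entry (B 3) a (nth 0 [:: i; j; k] b))).
by congr [:: _; _; _; _; _; _; _; _; _; _; _; _; _; _];
  (exact: P1 || exact: P2 || exact: P3).
Qed.

End FlagMinors.

(** * The open flag variety as a linear space *)

(** Parametrization of the linear space by [s_1, s_2, s_3, t_1, a_1, a_2], with
    columns in the order [s_1, s_2, s_3, x_1, x_2, x_3, t_1, t_2, t_3, a_1, a_2]:
    [x_1 = s_3 - s_2], [x_2 = s_3 - s_1], [x_3 = s_2 - s_1] and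
    [t_i = t_1 + s_i - s_1]. *)
Definition flag4_param_tab : seq (seq int) :=
 [:: [:: 1; 0; 0;  0; -1; -1;  0; -1; -1;  0; 0];
     [:: 0; 1; 0; -1;  0;  1;  0;  1;  0;  0; 0];
     [:: 0; 0; 1;  1;  1;  0;  0;  0;  1;  0; 0];
     [:: 0; 0; 0;  0;  0;  0;  1;  1;  1;  0; 0];
     [:: 0; 0; 0;  0;  0;  0;  0;  0;  0;  1; 0];
     [:: 0; 0; 0;  0;  0;  0;  0;  0;  0;  0; 1]].

Definition flag4_pivot_cols : seq nat := [:: 0; 1; 2; 6; 9; 10]%N.

Section FlagSpace.
Context (K : numFieldType).

Definition flag4_mx : 'M[K]_(6, 11) :=
  \matrix_(b, e) (nth 0 (nth [::] flag4_param_tab b) e)%:~R.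

Definition flag4_col (b : 'I_6) : 'I_11 := inord (nth 0%N flag4_pivot_cols b).

Lemma flag4_colE b : flag4_col b = nth 0%N flag4_pivot_cols b :> nat.
Proof. by rewrite inordK //; case: b => -[|[|[|[|[|[|]]]]]]. Qed.

Lemma flag4_mx_col b b' : flag4_mx b (flag4_col b') = (b == b')%:R.
Proof.
have /allP/(_ (val b)) : all (fun b => all (fun b' =>
    nth 0 (nth [::] flag4_param_tab b) (nth 0%N flag4_pivot_cols b') == (b == b'))
  (iota 0 6)) (iota 0 6).
  by vm_compute.
rewrite mem_iota ltn_ord => /(_ isT)/allP/(_ (val b')).
rewrite mem_iota ltn_ord => /(_ isT)/eqP bb'.
by rewrite mxE flag4_colE bb' (inj_eq val_inj); case: (b == b').
Qed.

Lemma sub_flag4_mx (z : seq K) : (\row_(e < 11) nth 0 z e <= flag4_mx)%MS <->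
  [/\ nth 0 z 3 = nth 0 z 2 - nth 0 z 1, nth 0 z 4 = nth 0 z 2 - nth 0 z 0,
      nth 0 z 5 = nth 0 z 1 - nth 0 z 0, nth 0 z 7 = nth 0 z 6 + nth 0 z 1 - nth 0 z 0
    & nth 0 z 8 = nth 0 z 6 + nth 0 z 2 - nth 0 z 0].
Proof.
have sumE (e : 'I_11) :
    \sum_b flag4_mx b e * (\row_(e < 11) nth 0 z e) 0 (flag4_col b) =
    \sum_(b <- iota 0 6) (nth 0 (nth [::] flag4_param_tab b) e)%:~R *
      nth 0 z (nth 0%N flag4_pivot_cols b).
  rewrite -[iota 0 6]/(index_iota 0 6) big_mkord; apply: eq_bigr => b _.
  by rewrite !mxE flag4_colE.
rewrite (sub_graph flag4_mx_col); split=> [H|[h3 h4 h5 h7 h8] e].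
  by split; [have := H (inord 3) | have := H (inord 4) | have := H (inord 5)
    | have := H (inord 7) | have := H (inord 8)];
    rewrite sumE mxE !inordK // !big_cons big_nil /= => ->; ring.
rewrite sumE mxE !big_cons big_nil.
by case: e => -[|[|[|[|[|[|[|[|[|[|[|]]]]]]]]]]] //= _;
  rewrite ?h3 ?h4 ?h5 ?h7 ?h8; ring.
Qed.

End FlagSpace.

Section Coordinates.
Context (R : realType).
Local Notation K := (R[i]).

Lemma flag4_torus_point (p : pidx 4 -> K)
    p1 p2 p3 p4 p12 p13 p23 p14 p24 p34 p123 p124 p134 p234 :
  [seq p (pidx4 s) | s <- flag4_bits] =
    [:: p1; p2; p3; p4; p12; p13; p23; p14; p24; p34; p123; p124; p134; p234] ->
  torus_point flag4_basis p = \row_e nth 0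
    [:: p1 / p4 / p14 * p34; p2 / p4 / p24 * p34; p3 / p4; p23 / p24; p13 / p14;
        p12 / p14 / p24 * p34; p12 * p13 / p14 / p24 / p123 * p234;
        p12 * p23 / p14 / p24 / p123 * p134; p13 * p23 / p14 / p24 / p123 * p124;
        p14 / p34; p24 / p34] e.
Proof.
case=> e1 e2 e3 e4 e12 e13 e23 e14 e24 e34 e123 e124 e134 e234.
apply/rowP => e; rewrite !mxE big_pidx4 big_seq.
rewrite (eq_bigr (fun s => p (pidx4 s) ^ tab bvec_tab e s)) => [|s sP]; last first.
  by rewrite ffunE pidx4K.
rewrite -big_seq !big_cons big_nil e1 e2 e3 e4 e12 e13 e23 e14 e24 e34 e123 e124 e134 e234.
have tabE i s : index s flag4_bits = i -> tab bvec_tab e s = nth 0 (nth [::] bvec_tab e) i.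
  by move=> <-.
rewrite !(tabE _ _ erefl) /=.
by case: e {tabE} => -[|[|[|[|[|[|[|[|[|[|[|]]]]]]]]]]] //= _;
  rewrite ?expr0z ?expr1z ?exprN1 ?mul1r ?mulr1; ring.
Qed.
End Coordinates.

Section FlagLocus.
Context (R : realType).
Local Notation K := (R[i]).

(** Since [F_1] lies in [F_2], the 3 x 3 minors of the generators of both
    vanish. *)
Lemma incidence12 (B : forall j, 'M[K]_(j, 4)) i j k : (B 1 <= B 2)%MS ->
  entry (B 1) 0 i * minor2 B j k - entry (B 1) 0 j * minor2 B i k +
  entry (B 1) 0 k * minor2 B i j = 0.
Proof.
move=> /submxP[c cE]; have E l : entry (B 1) 0 l =
    c 0 0 * entry (B 2) 0 l + c 0 1 * entry (B 2) 1 l.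
  rewrite /entry cE mxE !big_ord_recl big_ord0 addr0.
  by congr (c _ _ * B 2 _ _ + c _ _ * B 2 _ _); apply: val_inj; rewrite /= ?inordK.
by rewrite !E /minor2; ring.
Qed.

(** The vector of [F_2] whose entry at [m] is [minor2 B k m] vanishes at [k] and lies
    in [F_3]; this expands the vanishing determinant that it forms with the rows
    spanning [F_3]. *)
Lemma incidence23 (B : forall j, 'M[K]_(j, 4)) i j k l : (B 2 <= B 3)%MS ->
  minor3 B i k l * minor2 B j k - minor3 B j k l * minor2 B i k =
  minor3 B i j k * minor2 B k l.
Proof.
move=> /submxP[c cE]; have E a m : (a < 2)%N -> entry (B 2) a m =
    c (inord a) 0 * entry (B 3) 0 m + c (inord a) 1 * entry (B 3) 1 m +
    c (inord a) 2 * entry (B 3) 2 m.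
  move=> a2; rewrite /entry cE mxE !big_ord_recl big_ord0 addr0 addrA.
  by congr (c _ _ * B 3 _ _ + c _ _ * B 3 _ _ + c _ _ * B 3 _ _);
    apply: val_inj; rewrite /= ?inordK.
rewrite /minor2 !E // /minor3; ring.
Qed.

(** Divided by suitable monomials, the three-term incidence relations between the
    Plücker coordinates become linear in the coordinates of the torus. *)
Lemma open_flag_torus_point p :
  open_flag p -> arr_compl (flag4_mx K) (torus_point flag4_basis p).
Proof.
move=> [[B [_ Bsub] pB] p0]; split; first exact: torus_point_in.
have B12 : (B 1 <= B 2)%MS by exact: Bsub.
have B23 : (B 2 <= B 3)%MS by exact: Bsub.
have Pl := flag4_plucker B; rewrite -pB in Pl.
have : all (fun x => x != 0) [seq p (pidx4 s) | s <- flag4_bits].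
  by apply/allP => _ /mapP[s _ ->].
rewrite Pl /= => /and5P[_ _ _ b4 /and5P[_ _ _ m14 /and4P[m24 _ m123 _]]].
rewrite (flag4_torus_point Pl) sub_flag4_mx /=.
have r12 := incidence12 0 1 3 B12; have r13 := incidence12 0 2 3 B12.
have r23 := incidence12 1 2 3 B12.
have q2 := incidence23 0 1 2 3 B23; have q3 := incidence23 0 2 1 3 B23.
have {q3} : minor3 B 0 1 3 * minor2 B 1 2 - minor3 B 1 2 3 * minor2 B 0 1 =
    minor3 B 0 1 2 * minor2 B 1 3.
  move: q3; rewrite (_ : minor2 B 2 1 = - minor2 B 1 2); last by rewrite /minor2; ring.
  rewrite (_ : minor3 B 2 1 3 = - minor3 B 1 2 3); last by rewrite /minor3; ring.
  rewrite (_ : minor3 B 0 2 1 = - minor3 B 0 1 2); last by rewrite /minor3; ring.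
  by move=> q3; rewrite -[RHS]opprK -[- (minor3 B 0 1 2 * _)]mulNr -q3; ring.
move: b4 m14 m24 m123 r12 r13 r23 q2 {Pl B12 B23}.
move: (entry _ 0 0) (entry _ 0 1) (entry _ 0 2) (entry _ 0 3) => p1 p2 p3 p4.
move: (minor2 B 0 1) (minor2 B 0 2) (minor2 B 1 2) (minor2 B 0 3) (minor2 B 1 3)
  (minor2 B 2 3) => p12 p13 p23 p14 p24 p34.
move: (minor3 B 0 1 2) (minor3 B 0 1 3) (minor3 B 0 2 3) (minor3 B 1 2 3).
move=> p123 p124 p134 p234.
move=> p4_0 p14_0 p24_0 p123_0 r12 r13 r23.
move=> /eqP; rewrite -subr_eq0 => /eqP q2 /eqP; rewrite -subr_eq0 => /eqP q3.
split; apply/eqP; rewrite -subr_eq0.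
- rewrite (_ : _ - _ = (p2 * p34 - p3 * p24 + p4 * p23) / (p4 * p24)); last first.
    by field; rewrite p4_0 ?p14_0 ?p24_0 ?p123_0.
  by rewrite r23 mul0r.
- rewrite (_ : _ - _ = (p1 * p34 - p3 * p14 + p4 * p13) / (p4 * p14)); last first.
    by field; rewrite p4_0 ?p14_0 ?p24_0 ?p123_0.
  by rewrite r13 mul0r.
- rewrite (_ : _ - _ = (p1 * p24 - p2 * p14 + p4 * p12) * p34 / (p4 * p14 * p24)); last first.
    by field; rewrite p4_0 ?p14_0 ?p24_0 ?p123_0.
  by rewrite r12 !mul0r.
(* [t_2 - t_1 - x_3] and [x_3 - s_2 + s_1] vanish separately. *)
- rewrite (_ : _ - _ = (p134 * p23 - p234 * p13 - p123 * p34) * p12 / (p14 * p24 * p123)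
    + (p1 * p24 - p2 * p14 + p4 * p12) * p34 / (p4 * p14 * p24)); last first.
    by field; rewrite p4_0 ?p14_0 ?p24_0 ?p123_0.
  by rewrite r12 q2 !mul0r addr0.
- rewrite (_ : _ - _ = (p124 * p23 - p234 * p12 - p123 * p24) * p13 / (p14 * p24 * p123)
    + (p1 * p34 - p3 * p14 + p4 * p13) / (p4 * p14)); last first.
    by field; rewrite p4_0 ?p14_0 ?p24_0 ?p123_0.
  by rewrite r13 q3 !mul0r addr0.
Qed.
End FlagLocus.

Lemma colsub_row_free (K : fieldType) k n (M : 'M[K]_(k, n)) (f : 'I_k -> 'I_n) :
  \det (colsub f M) != 0 -> row_free M.
Proof.
rewrite -unitfE -/(_ \in unitmx) => Mu; apply: inj_row_free => y yM.
have : y *m colsub f M = 0.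
  by rewrite mulmx_colsub yM; apply/rowP => j; rewrite !mxE.
by move/(congr1 (mulmx^~ (invmx (colsub f M)))); rewrite mulmxK // mul0mx.
Qed.

Lemma plucker_row_free (R : realType) n (B : forall j, 'M[R[i]]_(j, n)) (A : pidx n) j :
  plucker B A != 0 -> #|val A| = j -> row_free (B j).
Proof. by move=> /colsub_row_free + <-. Qed.

Section FlagLocus.
Context (R : realType).
Local Notation K := (R[i]).

Definition row_flag (W : seq (seq K)) (j : nat) : 'M[K]_(j, 4) :=
  \matrix_(i < j, k < 4) nth 0 (nth [::] W i) k.

Lemma row_flag_sub W i j : (i <= j)%N -> (row_flag W i <= row_flag W j)%MS.
Proof.
move=> ij; rewrite (_ : row_flag W i = rowsub (widen_ord ij) (row_flag W j)).
  exact: rowsub_sub.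
by apply/matrixP => a b; rewrite !mxE.
Qed.

Lemma open_flag_row_flag W (p := plucker (row_flag W)) :
  all (fun x => x != 0) [seq p (pidx4 s) | s <- flag4_bits] -> open_flag p.
Proof.
move=> /allP p0; have {}p0 A : p A != 0.
  by apply: p0; apply/mapP; exists (bits A); rewrite ?bits_in ?bitsK.
split=> //; exists (row_flag W) => //; split=> [j|i j /andP[_ ij] _]; last exact: row_flag_sub.
case: j => [|[|[|[|]]]] // _.
- by apply: plucker_row_free (p0 (pidx4 [:: true; false; false; false])) _; rewrite card_pidx4.
- by apply: plucker_row_free (p0 (pidx4 [:: true; true; false; false])) _; rewrite card_pidx4.
- by apply: plucker_row_free (p0 (pidx4 [:: true; true; true; false])) _; rewrite card_pidx4.
Qed.

(** A flag with given coordinates. Normalize [p_4 = p_34 = 1]; then [F_1] is spanned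
    by [(s_1 a_1, s_2 a_2, s_3, 1)] and [F_2] contains [- (a_1, a_2, 1, 0)]. A
    further vector [(a_i rho_i, 0)] gives [p_jk4] proportional to
    [rho_k - rho_j], which must be proportional to
    [t_i (s_k - s_j) = (s_i + t) (s_k - s_j)], where [t = t_1 - s_1]. Since
    [s_i = s_1 + s_2 + s_3 - s_j - s_k], the quadratic polynomial
    [rho_i = (s_1 + s_2 + s_3 + t - s_i) s_i] has this property. *)
Lemma torus_point_surj z : arr_compl (flag4_mx K) z ->
  exists2 p, open_flag p & torus_point flag4_basis p = z.
Proof.
have zE : z = \row_(e < 11) nth 0 [seq z 0 (inord i) | i <- iota 0 11] e.
  apply/rowP => e; rewrite mxE (nth_map 0%N) ?size_iota // nth_iota // add0n.
  by rewrite inord_val.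
move=> [zT]; rewrite zE sub_flag4_mx /= => -[].
have {}zT i : z 0 (inord i) != 0 by exact: zT.
move: (zT 0) (zT 1) (zT 2) (zT 3) (zT 4) (zT 5) (zT 6) (zT 7) (zT 8) (zT 9) (zT 10).
move: (z 0 (inord 0)) (z 0 (inord 1)) (z 0 (inord 2)) (z 0 (inord 3)) (z 0 (inord 4))
  (z 0 (inord 5)) (z 0 (inord 6)) (z 0 (inord 7)) (z 0 (inord 8)) (z 0 (inord 9))
  (z 0 (inord 10)) => s1 s2 s3 x1 x2 x3 t1 t2 t3 a1 a2.
move=> s1_0 s2_0 s3_0 x1_0 x2_0 x3_0 t1_0 t2_0 t3_0 a1_0 a2_0 x1E x2E x3E t2E t3E.
pose rho s := (t1 + s2 + s3 - s) * s.
pose W := [:: [:: s1 * a1; s2 * a2; s3; 1]; [:: - a1; - a2; -1; 0];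
  [:: a1 * rho s1; a2 * rho s2; rho s3; 0]].
pose p := plucker (row_flag W).
have entryE k i j : (i <= k)%N -> (j < 4)%N ->
    entry (row_flag W k.+1) i j = nth 0 (nth [::] W i) j.
  by move=> ik j4; rewrite /entry mxE !inordK.
have PlE : [seq p (pidx4 s) | s <- flag4_bits] =
  [:: s1 * a1; s2 * a2; s3; 1; x3 * a1 * a2; x2 * a1; x1 * a2; a1; a2; 1;
     - (x1 * x2 * x3 * a1 * a2); - (x3 * t3 * a1 * a2); - (x2 * t2 * a1); - (x1 * t1 * a2)].
  rewrite flag4_plucker /minor2 /minor3 !entryE //= /rho t2E t3E x1E x2E x3E.
  by congr [:: _; _; _; _; _; _; _; _; _; _; _; _; _; _]; ring.
exists p.
  apply: open_flag_row_flag; rewrite -/p PlE /= !oppr_eq0 !mulf_neq0 // oner_neq0.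
  by rewrite s3_0 a1_0 a2_0.
rewrite (flag4_torus_point PlE); apply/rowP => e; rewrite !mxE.
by case: e => -[|[|[|[|[|[|[|[|[|[|[|]]]]]]]]]]] //= _; field;
  rewrite ?x1_0 ?x2_0 ?x3_0 ?a1_0 ?a2_0.
Qed.

Lemma open_flag_idealE :
  @open_flag_ideal R 4 = vanishing flag4_basis (arr_compl (flag4_mx K)).
Proof.
apply/seteqP; split=> f f0.
  move=> z /torus_point_surj [p pF <-]; rewrite -eval_ev ?f0 //.
  by case: pF.
move=> p pF; rewrite (eval_ev flag4_basis) ?f0 //; last by case: pF.
exact: open_flag_torus_point.
Qed.

End FlagLocus.

Theorem theorem1p2 (R : realType) (w : pidx 4 -> R) :
  Trop (@open_flag_ideal R 4) w ->
  smooth_quotient (initial_ideal w (@open_flag_ideal R 4)) /\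
  irreducible_quotient (initial_ideal w (@open_flag_ideal R 4)).
Proof.
rewrite open_flag_idealE; apply: linear_initial_degenerations.
exact: graph_row_free (@flag4_mx_col _).
Qed.
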